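(* Let $\mathbb{K}$ be a field and let $G$ be a finite simple claw-free graph which has no cycle other than $C_3$ and $C_5$ (that is, every cycle of $G$ has length $3$ or $5$). Then for every integer $k\geq 1$, $${\rm reg}(J(G)^{(k)})=k\,{\rm deg}(J(G)).$$
   Context: For $V(G)=\{x_1,\ldots,x_n\}$, let $S=\mathbb{K}[x_1,\ldots,x_n]$. The cover ideal is $J(G)=\bigcap_{x_ix_j\in E(G)}(x_i,x_j)$ and its $k$-th symbolic power is $J(G)^{(k)}=\bigcap_{x_ix_j\in E(G)}(x_i,x_j)^k$ (both equal $S$ if $G$ has no edges). The regularity of a graded $S$-module $M$ is ${\rm reg}(M)=\max\{j-i\mid \beta_{i,j}(M)\neq 0\}$. For a monomial ideal $I$, ${\rm deg}(I)$ is the maximum degree of its minimal monomial generators; thus ${\rm deg}(J(G))$ is the largest cardinality of a minimal (with respect to inclusion) vertex cover of $G$. A graph is claw-free if it has no $K_{1,3}$ as an induced subgraph. Cycles of $G$ are cycle subgraphs, not necessarily induced; $C_m$ is the cycle with $m$ vertices. *)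

(* Defs.v *)
From HB Require Import structures.
From mathcomp Require Import all_boot all_order all_algebra.
From mathcomp Require Import mpoly.

Set Implicit Arguments.
Unset Strict Implicit.
Unset Printing Implicit Defensive.

Import Order.TTheory GRing.Theory Num.Theory.
Local Open Scope ring_scope.

Definition is_max (disp : Order.disp_t) (T : porderType disp)
    (A : T -> Prop) (m : T) : Prop :=
  A m /\ forall a, A a -> (a <= m)%O.

Section Graphs.
Variables (V : finType) (e : rel V).

(* K_{1,3} on {0,1,2,3}, with centre 0. *)
Definition K13 : rel 'I_4 := fun i j => (i == ord0) != (j == ord0).

Definition induced_subgraph (W : finType) (h : rel W) : Prop :=
  exists f : W -> V, injective f /\ forall i j, e (f i) (f j) = h i j.

Definition claw_free : Prop := ~ induced_subgraph K13.

(* A cycle subgraph with m >= 3 vertices is listed by a duplicate-free cyclic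
   sequence of vertices; chords are allowed. *)
Definition only_C3_C5 : Prop :=
  forall c : seq V, (2 < size c)%N -> ucycle e c -> size c = 3%N \/ size c = 5%N.

End Graphs.

Section Ideals.
Variables (K : fieldType) (n : nat).
Local Notation S := {mpoly K[n]}.

Definition same_set (I J : S -> Prop) : Prop := forall p, I p <-> J p.

Definition ideal_gen (A : S -> Prop) : S -> Prop := fun p =>
  exists s : seq (S * S),
    (forall q, q \in s -> A q.2) /\ p = \sum_(q <- s) q.1 * q.2.

Definition ideal_mul (I J : S -> Prop) : S -> Prop :=
  ideal_gen (fun p => exists a b, [/\ I a, J b & p = a * b]).

Fixpoint ideal_pow (I : S -> Prop) (k : nat) : S -> Prop :=
  if k is k'.+1 then ideal_mul I (ideal_pow I k') else fun _ => True.

Definition edge_prime (i j : 'I_n) : S -> Prop :=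
  ideal_gen (fun p => p = 'X_i \/ p = 'X_j).

(* Empty intersections are the whole ring. *)
Definition cover_ideal (e : rel 'I_n) : S -> Prop := fun p =>
  forall i j, e i j -> edge_prime i j p.

Definition symbolic_power (e : rel 'I_n) (k : nat) : S -> Prop := fun p =>
  forall i j, e i j -> ideal_pow (edge_prime i j) k p.

Definition monomial_ideal_gen (A : 'X_{1..n} -> Prop) : S -> Prop :=
  ideal_gen (fun p => exists m, A m /\ p = 'X_[m]).

Definition min_monomial_generators (I : S -> Prop) (A : 'X_{1..n} -> Prop) :=
  same_set (monomial_ideal_gen A) I /\
  forall B : 'X_{1..n} -> Prop, (forall m, B m -> A m) ->
    same_set (monomial_ideal_gen B) I -> forall m, A m -> B m.

(* [ideal_deg I d] : the maximum degree of a minimal monomial generator of I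
   is d. *)
Definition ideal_deg (I : S -> Prop) (d : nat) : Prop :=
  is_max (fun t : nat => exists A m,
    [/\ min_monomial_generators I A, A m & t = mdeg m]) d.

(* The zero polynomial is homogeneous of every degree, and is the only
   homogeneous polynomial of negative degree. *)
Definition homog_deg (z : int) (p : S) : bool :=
  match z with Posz d => p \is d.-homog | Negz _ => p == 0 end.

(* Data of a sequence  ... -> F_1 -> F_0 -> S  with
   F_i = \bigoplus_(a < rk i) S(- shift i a);
   elements of F_i are row vectors and maps act by right multiplication. *)
Record free_sequence := FreeSequence {
  rk : nat -> nat;
  shift : forall i, 'I_(rk i) -> int;
  diff : forall i, 'M[S]_(rk i.+1, rk i);
  aug : 'cV[S]_(rk 0) }.

Record min_graded_free_resolution (F : free_sequence) (I : S -> Prop) : Prop :=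
  MinGradedFreeResolution {
  aug_graded : forall a, homog_deg (shift a) (aug F a 0);
  diff_graded : forall i b a, homog_deg (shift b - shift a) (diff F i b a);
  aug_image : forall p, I p <-> exists v : 'rV[S]_(rk F 0), v *m aug F = p%:M;
  exact_0 : forall v : 'rV[S]_(rk F 0),
    v *m aug F = 0 <-> exists w : 'rV[S]_(rk F 1), v = w *m diff F 0;
  exact_S : forall i (v : 'rV[S]_(rk F i.+1)),
    v *m diff F i = 0 <-> exists w : 'rV[S]_(rk F i.+2), v = w *m diff F i.+1;
  (* minimality: the image of F_(i+1) lies in (x_1, ..., x_n) F_i *)
  diff_minimal : forall i b a, (diff F i b a)@_0%MM = 0 }.

(* [graded_betti I i j b] : beta_(i,j)(I) = b.  Minimal graded free resolutions
   are unique up to isomorphism, so b does not depend on F. *)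
Definition graded_betti (I : S -> Prop) (i : nat) (j : int) (b : nat) : Prop :=
  exists F : free_sequence, min_graded_free_resolution F I /\
    b = #|[set a : 'I_(rk F i) | shift a == j]|.

(* [regularity I r] : reg(I) = r. *)
Definition regularity (I : S -> Prop) (r : int) : Prop :=
  is_max (fun t : int => exists i j b,
    [/\ graded_betti I i j b, b != 0%N & t = j - i%:Z]) r.

End Ideals.

(* Main.v *)
Require Import Defs.
From HB Require Import structures.
From mathcomp Require Import all_boot all_order all_algebra.
From mathcomp Require Import mpoly zify.
From Stdlib Require Import ClassicalEpsilon.

(** The [k]-th symbolic power of the cover ideal is the monomial ideal of the
    [k]-covers of the graph, the weights [m] on the vertices with
    [m i + m j >= k] on every edge. If [m] is the indicator of a minimal vertex
    cover of the largest size [d], then [k m] is a minimal [k]-cover, so the ideal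
    has a minimal generator of degree [k d]; this is the lower bound. The upper
    bound has a combinatorial half and an algebraic half.

    Regularity is at most the largest degree of a minimal generator
    ([reg_le_kcover]). The induction runs over the ideals of [k]-covers bounded
    below by a weight [l]. For a vertex [x] such an ideal is the sum of the part
    with weight exactly [l x] at [x] and the part with weight at least [l x + 1];
    both have the same form, and so has their intersection, which is [x] times
    the first part. The cone of Mayer-Vietoris ([reg_le_sum]) bounds the
    regularity of the sum. The generators do not grow if [x] is chosen so that
    raising its bound creates no new minimal cover. Such a shedding vertex exists
    whenever some edge is not yet satisfied by the bounds ([shedding_exists]): in
    the graph of these edges, a path that cannot be extended ends in a simplicial
    vertex or on a five-cycle, because all cycles have length 3 or 5; and a
    five-cycle is a whole component, because the graph is claw-free.

    A minimal [k]-cover has degree at most [k d] ([min_cover_degree]). The level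
    sets of [k - m], taken in pairs of thresholds [t] and [k + 1 - t], produce
    maximal independent sets of at most the average size of the two level sets,
    because in a claw-free graph some independent dominating set consists of the
    isolated vertices and at most half of the others ([claw_free_domination]). The complement of a
    maximal independent set is a minimal vertex cover.

    The regularity is read off minimal graded free resolutions, so two facts
    about these are established: they exist ([min_resolution_exists], from
    Dickson's lemma and Hilbert's basis theorem), and their shifts occur in every
    graded resolution ([min_shift_le], by comparison and homotopy), so that the
    non-minimal resolutions given by cones may be used for upper bounds. *)

Set Implicit Arguments.
Unset Strict Implicit.
Unset Printing Implicit Defensive.

Import Order.TTheory GRing.Theory Num.Theory.
Local Open Scope ring_scope.

(** * Homogeneous components and graded matrices *)

Section GradedMatrices.
Variables (K : fieldType) (n : nat).
Local Notation S := {mpoly K[n]}.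
Implicit Types (p q : S) (z w : int).

Lemma homog_degP z p :
  reflect (forall m, m \in msupp p -> (mdeg m)%:Z = z) (homog_deg z p).
Proof.
case: z => d /=; first by apply: (iffP (dhomogP _ _ _)) => h m /h; [move=> -> | case].
apply: (iffP eqP) => [-> m|h]; first by rewrite msupp0.
by apply: msuppnil0; case E: (msupp p) => [//|m s]; have := h m; rewrite E mem_head => /(_ isT).
Qed.

Lemma homog_deg0 z : homog_deg z (0 : S).
Proof. by apply/homog_degP => m; rewrite msupp0. Qed.

Lemma homog_degD z p q : homog_deg z p -> homog_deg z q -> homog_deg z (p + q).
Proof.
move=> /homog_degP hp /homog_degP hq; apply/homog_degP => m /msuppD_le.
by rewrite mem_cat => /orP[/hp|/hq].
Qed.

Lemma homog_degN z p : homog_deg z p -> homog_deg z (- p).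
Proof.
by move=> /homog_degP hp; apply/homog_degP => m; rewrite (perm_mem (msuppN p)) => /hp.
Qed.

Lemma homog_degM z w p q :
  homog_deg z p -> homog_deg w q -> homog_deg (z + w) (p * q).
Proof.
move=> /homog_degP hp /homog_degP hq; apply/homog_degP => m.
move=> /msuppM_le/allpairsP[[m1 m2] /= [/hp <- /hq <- ->]].
by rewrite mdegD PoszD.
Qed.

Lemma homog_deg_sum z (I : Type) (r : seq I) (P : pred I) (G : I -> S) :
  (forall i, P i -> homog_deg z (G i)) -> homog_deg z (\sum_(i <- r | P i) G i).
Proof.
move=> h; elim/big_ind: _ => //; [exact: homog_deg0 | exact: homog_degD].
Qed.

Lemma homog_deg_const z p : homog_deg z p -> p@_0%MM != 0 -> z = 0.
Proof. by move=> /homog_degP h; rewrite -mcoeff_msupp => /h; rewrite mdeg0. Qed.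

(** The homogeneous component of degree [z]; it is [0] for negative [z], so that
    degrees computed as differences of shifts need no positivity check. *)
Definition hcomp z p : S := if z is Posz d then pihomog mdeg d p else 0.

Lemma mcoeff_hcomp z p m : (hcomp z p)@_m = p@_m *+ ((mdeg m)%:Z == z).
Proof.
case: z => d; last by rewrite mcoeff0.
rewrite /hcomp pihomogE raddf_sum /= -big_filter.
rewrite eqz_nat; have [md|md] := eqVneq (mdeg m) d; last first.
  rewrite big1_seq ?mulr0n // => m'; rewrite mem_filter andTb => /andP[/eqP m'd _].
  by rewrite mcoeffZ mcoeffX; case: eqP => [e|]; [rewrite -m'd e eqxx in md | rewrite mulr0].
have [mp|mp] := boolP (m \in msupp p).
  rewrite (big_rem m) /=; last by rewrite mem_filter md eqxx.
  rewrite mcoeffZ mcoeffX eqxx mulr1 big1_seq ?addr0 // => m' /=.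
  rewrite mem_rem_uniq ?filter_uniq ?msupp_uniq // inE => /andP[ne _].
  by rewrite mcoeffZ mcoeffX (negPf ne) mulr0.
rewrite (memN_msupp_eq0 mp) mul0rn big1_seq // => m' /=.
rewrite mem_filter => /andP[_ m'p]; rewrite mcoeffZ mcoeffX.
by case: eqP => [e|]; [rewrite -e m'p in mp | rewrite mulr0].
Qed.

Lemma hcomp_homog z p : homog_deg z (hcomp z p).
Proof.
apply/homog_degP => m; rewrite mcoeff_msupp mcoeff_hcomp.
by case: (_ =P z) => // _; rewrite mulr0n eqxx.
Qed.

Lemma hcomp_id z p : homog_deg z p -> hcomp z p = p.
Proof.
move=> /homog_degP h; apply/mpolyP => m; rewrite mcoeff_hcomp.
have [/h ->|/memN_msupp_eq0 ->] := boolP (m \in msupp p); first by rewrite eqxx.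
by rewrite mul0rn.
Qed.

(** Taking components commutes with multiplication by a homogeneous polynomial.
    This is what allows any polynomial solution of a homogeneous linear system
    to be replaced by a homogeneous one. *)
Lemma hcompM z w p q : homog_deg w q -> hcomp (z + w) (p * q) = hcomp z p * q.
Proof.
move=> /homog_degP hq; apply/mpolyP => m; rewrite mcoeff_hcomp !mcoeffM.
rewrite -sumrMnl; apply: eq_bigr => -[k1 k2] /= /eqP mE.
have -> : ((mdeg m)%:Z == z + w) = ((mdeg k1)%:Z + (mdeg k2)%:Z == z + w).
  by rewrite {1}mE mdegD PoszD.
have [/hq e2|/memN_msupp_eq0 ->] := boolP (bmnm k2 \in msupp q); last by rewrite !mulr0 mul0rn.
by rewrite mcoeff_hcomp e2 (inj_eq (addIr _)) mulrnAl.
Qed.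

Lemma hcomp_sum z (I : Type) (r : seq I) (P : pred I) (G : I -> S) :
  hcomp z (\sum_(i <- r | P i) G i) = \sum_(i <- r | P i) hcomp z (G i).
Proof.
apply/mpolyP => m; rewrite mcoeff_hcomp !(raddf_sum (mcoeff m)) -sumrMnl.
by apply: eq_bigr => i _; rewrite /= mcoeff_hcomp.
Qed.

(** The matrix of a degree-preserving map between free modules with the given
    shifts, for the convention of row vectors acting on the left. *)
Definition mx_graded s t (sh : 'I_s -> int) (sh' : 'I_t -> int) (M : 'M[S]_(s, t)) :=
  forall b a, homog_deg (sh b - sh' a) (M b a).

Definition mx_hcomp s t (sh : 'I_s -> int) (sh' : 'I_t -> int) (M : 'M[S]_(s, t)) :=
  \matrix_(b, a) hcomp (sh b - sh' a) (M b a).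

Lemma mx_hcomp_graded s t (sh : 'I_s -> int) (sh' : 'I_t -> int) (M : 'M[S]_(s, t)) :
  mx_graded sh sh' (mx_hcomp sh sh' M).
Proof. by move=> b a; rewrite mxE; apply: hcomp_homog. Qed.

Lemma mx_hcomp_id s t (sh : 'I_s -> int) (sh' : 'I_t -> int) (M : 'M[S]_(s, t)) :
  mx_graded sh sh' M -> mx_hcomp sh sh' M = M.
Proof. by move=> h; apply/matrixP => b a; rewrite mxE hcomp_id. Qed.

Lemma mx_hcompM s t u (sh : 'I_s -> int) (sh' : 'I_t -> int) (sh'' : 'I_u -> int)
    (M : 'M[S]_(s, t)) (D : 'M[S]_(t, u)) :
  mx_graded sh' sh'' D -> mx_hcomp sh sh'' (M *m D) = mx_hcomp sh sh' M *m D.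
Proof.
move=> hD; apply/matrixP => b a; rewrite !mxE hcomp_sum; apply: eq_bigr => c _.
rewrite mxE -(hcompM _ _ (hD c a)); congr hcomp; lia.
Qed.

Lemma mx_gradedM s t u (sh : 'I_s -> int) (sh' : 'I_t -> int) (sh'' : 'I_u -> int)
    (M : 'M[S]_(s, t)) (D : 'M[S]_(t, u)) :
  mx_graded sh sh' M -> mx_graded sh' sh'' D -> mx_graded sh sh'' (M *m D).
Proof.
move=> hM hD b a; rewrite mxE; apply: homog_deg_sum => c _.
have -> : sh b - sh'' a = (sh b - sh' c) + (sh' c - sh'' a) by lia.
exact: homog_degM.
Qed.

(** The matrix modulo the maximal ideal: tensoring with the residue field. *)
Definition const_part s t (M : 'M[S]_(s, t)) : 'M[K]_(s, t) := map_mx (mcoeff 0%MM) M.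

Lemma row_lift s t u (M : 'M[S]_(s, u)) (D : 'M[S]_(t, u)) :
  (forall b, exists w : 'rV_t, row b M = w *m D) -> exists N, M = N *m D.
Proof.
move=> /fin_all_exists[w hw]; exists (\matrix_b w b); apply/row_matrixP => b.
by rewrite hw row_mul rowK.
Qed.

(** A graded matrix whose rows lie in the row span of a graded matrix factors
    through it by a graded matrix: take any factor and keep, in each entry, the
    component of the required degree. *)
Lemma graded_lift s t u (sh : 'I_s -> int) (sh' : 'I_t -> int) (sh'' : 'I_u -> int)
    (M : 'M[S]_(s, u)) (D : 'M[S]_(t, u)) :
    mx_graded sh sh'' M -> mx_graded sh' sh'' D ->
    (forall b, exists w : 'rV_t, row b M = w *m D) ->
  exists2 N, mx_graded sh sh' N & M = N *m D.
Proof.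
move=> hM hD /row_lift[N MN]; exists (mx_hcomp sh sh' N); first exact: mx_hcomp_graded.
by rewrite -(mx_hcompM _ _ hD) -MN mx_hcomp_id.
Qed.

End GradedMatrices.

(** * Graded resolutions, comparison and homotopy *)

Section Resolutions.
Variables (K : fieldType) (n : nat).
Local Notation S := {mpoly K[n]}.
Implicit Types (F G : free_sequence K n) (I J : S -> Prop).

(** Augmented indexing of [... -> F_1 -> F_0 -> S]: the ring itself is placed in
    position 0 and [F_i] in position [i.+1]. The augmentation then becomes the
    differential number 0, and the two exactness conditions become one. *)
Definition arank F i := if i is j.+1 then rk F j else 1%N.

Definition ashift F i : 'I_(arank F i) -> int :=
  if i is j.+1 then fun a => shift a else fun=> 0.

Definition adiff F i : 'M[S]_(arank F i.+1, arank F i) :=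
  if i is j.+1 then diff F j else aug F.

(** A graded free resolution that need not be minimal; the cones below are not
    minimal in general. *)
Record graded_resolution F I : Prop := GradedResolution {
  res_graded : forall i, mx_graded (@ashift F i.+1) (@ashift F i) (adiff F i);
  res_image : forall p, I p <-> exists v : 'rV[S]_(rk F 0), v *m aug F = p%:M;
  res_exact : forall i (v : 'rV[S]_(arank F i.+1)),
    v *m adiff F i = 0 <-> exists w : 'rV[S]_(arank F i.+2), v = w *m adiff F i.+1 }.

Lemma min_resolution_graded F I : min_graded_free_resolution F I -> graded_resolution F I.
Proof.
case=> ag dg ai e0 eS dm; split=> //.
- case=> [|i] b a /=; last exact: dg.
  by rewrite subr0 ord1.
- by case.
Qed.

Lemma graded_resolution_min F I : graded_resolution F I ->
    (forall i, const_part (diff F i) = 0) -> min_graded_free_resolution F I.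
Proof.
case=> gr im ex cst; split=> //.
- by move=> a; have := gr 0%N a 0; rewrite /= subr0.
- by move=> i b a; exact: (gr i.+1).
- exact: (ex 0%N).
- by move=> i; exact: (ex i.+1).
- by move=> i b a; move/matrixP/(_ b a): (cst i); rewrite !mxE.
Qed.

Lemma min_resolution_const F I : min_graded_free_resolution F I ->
  forall i, const_part (diff F i) = 0.
Proof. by case=> _ _ _ _ _ dm i; apply/matrixP => b a; rewrite !mxE. Qed.

Lemma eq_graded_resolution F I J : same_set I J ->
  graded_resolution F I -> graded_resolution F J.
Proof. by move=> IJ [gr im ex]; split=> // p; rewrite -IJ. Qed.

Lemma adiff_comp F I i : graded_resolution F I -> adiff F i.+1 *m adiff F i = 0.
Proof.
case=> _ _ ex; apply/row_matrixP => b; rewrite row_mul row0.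
by apply/ex; exists (delta_mx 0 b); rewrite -rowE.
Qed.

Lemma aug_in F I a : graded_resolution F I -> I (aug F a 0).
Proof.
case=> _ im _; apply/im; exists (delta_mx 0 a).
by rewrite -rowE; apply/matrixP => i j; rewrite !ord1 !mxE.
Qed.

(** Any graded resolution bounds the regularity from above, see
    [min_shift_le]. *)
Definition reg_le I (r : int) := exists2 F, graded_resolution F I &
  forall i (a : 'I_(rk F i)), shift a <= r + i%:Z.

(** Choice of a dependent sequence one term at a time, used for chain maps and
    homotopies: [Q] is the invariant that makes the next choice possible. *)
Lemma dependent_recursion (T : nat -> Type) (Q : forall i, T i -> Prop)
    (R : forall i, T i -> T i.+1 -> Prop) (x0 : T 0%N) :
    Q _ x0 -> (forall i x, Q i x -> exists2 y, R i x y & Q _ y) ->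
  exists f : forall i, T i, [/\ f 0%N = x0, forall i, Q i (f i) & forall i, R i (f i) (f i.+1)].
Proof.
move=> Q0 step.
have next i (x : {x : T i | Q i x}) :
    {y : {y : T i.+1 | Q _ y} | R i (proj1_sig x) (proj1_sig y)}.
  apply: constructive_indefinite_description; case: x => x Qx /=.
  by have [y Rxy Qy] := step i x Qx; exists (exist _ y Qy).
pose g := fix g i : {x : T i | Q i x} :=
  if i is j.+1 then proj1_sig (next j (g j)) else exist _ x0 Q0.
exists (fun i => proj1_sig (g i)); split=> // i; first exact: proj2_sig.
exact: (proj2_sig (next i (g i))).
Qed.

(** The comparison theorem for the inclusion of an ideal in another one. The
    invariant is that the image of a row of the differential is again a cycle,
    hence a boundary. *)
Lemma chain_lift F G I J : graded_resolution F I -> graded_resolution G J ->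
    (forall p, I p -> J p) ->
  exists f : forall i, 'M[S]_(arank F i, arank G i),
    [/\ f 0%N = 1%:M, forall i, mx_graded (@ashift F i) (@ashift G i) (f i)
      & forall i, adiff F i *m f i = f i.+1 *m adiff G i].
Proof.
move=> resF resG sIJ.
pose Q i (f : 'M[S]_(arank F i, arank G i)) :=
  mx_graded (@ashift F i) (@ashift G i) f /\
  forall b, exists w : 'rV_(arank G i.+1), row b (adiff F i *m f) = w *m adiff G i.
pose R i (f : 'M[S]_(arank F i, arank G i)) f' := adiff F i *m f = f' *m adiff G i.
have [||f [f0 fQ fR]] := @dependent_recursion _ Q R 1%:M.
- split=> [b a|b]; first by rewrite mxE !ord1 eqxx subrr; exact: dhomog1.
  have [w wE] := (res_image resG _).1 (sIJ _ (aug_in b resF)).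
  exists w; rewrite mulmx1 wE; apply/matrixP => i j.
  by rewrite !ord1 !mxE eqxx.
- move=> i f [fg fim].
  have [f' f'g f'E] :=
    graded_lift (mx_gradedM (res_graded resF (i:=i)) fg) (res_graded resG (i:=i)) fim.
  exists f' => //; split=> // b.
  have [w wE] : exists w : 'rV_(arank G i.+2), row b (adiff F i.+1 *m f') = w *m adiff G i.+1.
    by apply/(res_exact resG); rewrite -row_mul -mulmxA -f'E mulmxA (adiff_comp _ resF) mul0mx row0.
  by exists w.
exists f; split=> // i; by case: (fQ i).
Qed.

(** A chain endomorphism of a resolution that vanishes on the ring is
    null-homotopic. *)
Lemma null_homotopy F I (f : forall i, 'M[S]_(arank F i, arank F i)) :
    graded_resolution F I -> f 0%N = 0 ->
    (forall i, adiff F i *m f i = f i.+1 *m adiff F i) ->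
  exists h : forall i, 'M[S]_(arank F i, arank F i.+1),
    h 0%N = 0 /\ forall i, f i.+1 = h i.+1 *m adiff F i.+1 + adiff F i *m h i.
Proof.
move=> resF f0 fE.
pose Q i (h : 'M[S]_(arank F i, arank F i.+1)) :=
  adiff F i *m (f i - h *m adiff F i) = 0.
pose R i (h : 'M[S]_(arank F i, arank F i.+1)) h' :=
  f i.+1 = h' *m adiff F i.+1 + adiff F i *m h.
have [||h [h0 hQ hR]] := @dependent_recursion _ Q R 0; last by exists h.
- by rewrite /Q f0 mul0mx subrr mulmx0.
- move=> i h hQ.
  have [h' h'E] : exists h', f i.+1 - adiff F i *m h = h' *m adiff F i.+1.
    apply: row_lift => b; apply/(res_exact resF).
    rewrite -row_mul mulmxBl -fE -mulmxA -mulmxBr.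
    by rewrite hQ row0.
  exists h'; first by rewrite /R -h'E subrK.
  by rewrite /Q -h'E opprB addrCA subrr addr0 mulmxA (adiff_comp _ resF) mul0mx.
Qed.

(** Degrees occurring in a minimal resolution [F] occur in every graded
    resolution [P] of the same ideal. Lift the identity to [A : F -> P] and
    [B : P -> F]; the composite differs from the identity by a homotopy, and the
    differentials of [F] vanish modulo the maximal ideal, so [A B = 1] there.
    Hence each row of [A] has a nonzero constant entry, and by homogeneity such
    an entry joins generators of equal degree. *)
Lemma min_shift_le F P I r : min_graded_free_resolution F I ->
    graded_resolution P I -> (forall i (a : 'I_(rk P i)), shift a <= r + i%:Z) ->
  forall i (a : 'I_(rk F i)), shift a <= r + i%:Z.
Proof.
move=> minF resP leP i a; have resF := min_resolution_graded minF.
have [A [A0 Ag AE]] := chain_lift resF resP (fun p (h : I p) => h).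
have [B [B0 Bg BE]] := chain_lift resP resF (fun p (h : I p) => h).
have [|j|h [h0 hE]] := @null_homotopy F I (fun j => A j *m B j - 1%:M) resF.
- by rewrite A0 B0 mulmx1 subrr.
- by rewrite mulmxBr mulmxBl mulmx1 mul1mx mulmxA AE -mulmxA BE mulmxA.
have cM s t u (M : 'M[S]_(s, t)) (N : 'M[S]_(t, u)) :
    const_part (M *m N) = const_part M *m const_part N by exact: map_mxM.
have h00 : const_part (adiff F i *m h i) = 0.
  case: i a => [|i] a; first by rewrite h0 mulmx0 /const_part map_mx0.
  by rewrite cM /= (min_resolution_const minF) mul0mx.
have /matrixP/(_ a a) : const_part (A i.+1) *m const_part (B i.+1) = 1%:M.
  rewrite -cM -[X in const_part X](subrK 1%:M) (hE i) /const_part !map_mxD /=.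
  rewrite -!/(const_part _) h00 addr0 cM (min_resolution_const minF) mulmx0 add0r.
  exact: map_mx1.
rewrite !mxE eqxx; have [c nz _|none] := pickP (fun c => const_part (A i.+1) a c != 0); last first.
  by move/esym/eqP; rewrite big1 ?oner_eq0 // => c _; move/negPn/eqP: (none c) ->; rewrite mul0r.
rewrite mxE in nz; have := homog_deg_const (Ag i.+1 a c) nz.
by move/eqP; rewrite subr_eq0 => /eqP /= ->.
Qed.

End Resolutions.

(** * The Mayer-Vietoris cone *)

Section MayerVietoris.
Variables (K : fieldType) (n : nat).
Local Notation S := {mpoly K[n]}.

Definition sum_shift s t (sh1 : 'I_s -> int) (sh2 : 'I_t -> int) (a : 'I_(s + t)) :=
  match split a with inl b => sh1 b | inr b => sh2 b end.

Lemma sum_shift_le s t (sh1 : 'I_s -> int) (sh2 : 'I_t -> int) (z : int) :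
  (forall a, sh1 a <= z) -> (forall a, sh2 a <= z) -> forall a, sum_shift sh1 sh2 a <= z.
Proof. by rewrite /sum_shift => le1 le2 a; case: split. Qed.

Lemma col_mx_graded s1 s2 t (sh1 : 'I_s1 -> int) (sh2 : 'I_s2 -> int) (sh : 'I_t -> int)
    (M1 : 'M[S]_(s1, t)) (M2 : 'M_(s2, t)) :
  mx_graded sh1 sh M1 -> mx_graded sh2 sh M2 ->
  mx_graded (sum_shift sh1 sh2) sh (col_mx M1 M2).
Proof. by rewrite /sum_shift => g1 g2 b a; rewrite mxE; case: split. Qed.

Lemma row_mx_graded s1 s2 t (sh1 : 'I_s1 -> int) (sh2 : 'I_s2 -> int) (sh : 'I_t -> int)
    (M1 : 'M[S]_(t, s1)) (M2 : 'M_(t, s2)) :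
  mx_graded sh sh1 M1 -> mx_graded sh sh2 M2 ->
  mx_graded sh (sum_shift sh1 sh2) (row_mx M1 M2).
Proof. by rewrite /sum_shift => g1 g2 b a; rewrite mxE; case: split. Qed.

Lemma mx0_graded s t (sh : 'I_s -> int) (sh' : 'I_t -> int) :
  mx_graded sh sh' (0 : 'M[S]_(s, t)).
Proof. by move=> b a; rewrite mxE; apply: homog_deg0. Qed.

Lemma mxN_graded s t (sh : 'I_s -> int) (sh' : 'I_t -> int) (M : 'M[S]_(s, t)) :
  mx_graded sh sh' M -> mx_graded sh sh' (- M).
Proof. by move=> g b a; rewrite mxE; apply: homog_degN. Qed.

Section Cone.
Variables (FA FB FC : free_sequence K n).
Variables (f : forall i, 'M[S]_(arank FC i, arank FA i)).
Variables (g : forall i, 'M[S]_(arank FC i, arank FB i)).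

(** The modules of the third resolution enter the cone shifted by one step: in
    position [i] it contributes what [FC] has in position [i - 1]. *)
Definition cone_rk i := if i is j.+1 then rk FC j else 0%N.

Definition cone_shift i : 'I_(cone_rk i) -> int :=
  if i is j.+1 then fun a => shift a else fun=> 0.

(** The sign makes the square of the differential of the cone vanish. *)
Definition cone_diff i : 'M[S]_(rk FC i, cone_rk i) :=
  if i is j.+1 then - diff FC j else 0.

Definition cone : free_sequence K n := {|
  rk := fun i => (rk FA i + rk FB i + cone_rk i)%N;
  shift := fun i => sum_shift (sum_shift (@shift _ _ FA i) (@shift _ _ FB i)) (@cone_shift i);
  diff := fun i => block_mx (block_mx (diff FA i) 0 0 (diff FB i)) 0
                            (row_mx (f i.+1) (- g i.+1)) (cone_diff i);
  aug := col_mx (col_mx (aug FA) (aug FB)) 0 |}.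

Lemma cone_augE (u1 : 'rV_(rk FA 0)) (u2 : 'rV_(rk FB 0)) (w : 'rV_0) :
  (row_mx (row_mx u1 u2) w : 'rV_(rk cone 0)) *m aug cone = u1 *m aug FA + u2 *m aug FB.
Proof. by rewrite /= !mul_row_col mulmx0 addr0. Qed.

Lemma cone_diffE i (u1 : 'rV_(rk FA i.+1)) (u2 : 'rV_(rk FB i.+1)) (w : 'rV_(rk FC i)) :
  (row_mx (row_mx u1 u2) w : 'rV_(rk cone i.+1)) *m diff cone i =
  row_mx (row_mx (u1 *m diff FA i + w *m f i.+1) (u2 *m diff FB i - w *m g i.+1))
         (w *m cone_diff i).
Proof.
by rewrite /= mul_row_block mul_row_block !mulmx0 mul_mx_row addr0 !add0r mulmxN add_row_mx.
Qed.

Variables (A B : S -> Prop).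
Hypotheses (resA : graded_resolution FA A) (resB : graded_resolution FB B).
Hypothesis resC : graded_resolution FC (fun p => A p /\ B p).
Hypotheses (f0 : f 0%N = 1%:M) (g0 : g 0%N = 1%:M).
Hypotheses (fg : forall i, mx_graded (@ashift _ _ FC i) (@ashift _ _ FA i) (f i)).
Hypotheses (gg : forall i, mx_graded (@ashift _ _ FC i) (@ashift _ _ FB i) (g i)).
Hypotheses (fE : forall i, adiff FC i *m f i = f i.+1 *m adiff FA i).
Hypotheses (gE : forall i, adiff FC i *m g i = g i.+1 *m adiff FB i).

Lemma cone_diff_comp i : diff FC i *m cone_diff i = 0.
Proof.
case: i => [|i] /=; first exact: mulmx0.
by rewrite mulmxN (adiff_comp i.+1 resC) oppr0.
Qed.

(** The last component of a cycle of the cone is a cycle of [FC]; in position 0,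
    where [FC] contributes no condition, this follows from the chain map. *)
Lemma cone_cycle i (u1 : 'rV_(rk FA i.+1)) (w : 'rV_(rk FC i)) :
  u1 *m diff FA i + w *m f i.+1 = 0 -> w *m cone_diff i = 0 -> w *m adiff FC i = 0.
Proof.
case: i u1 w => [|i] u1 w /eqP; last first.
  by move=> _ /= /eqP; rewrite mulmxN oppr_eq0 => /eqP.
rewrite addr_eq0 => /eqP u1E _.
have -> : w *m adiff FC 0 = w *m f 1 *m adiff FA 0 by rewrite -mulmxA -fE f0 mulmx1.
have -> : w *m f 1 = - (u1 *m adiff FA 1) by rewrite [u1 *m _]u1E opprK.
by rewrite mulNmx -mulmxA (adiff_comp 0 resA) mulmx0 oppr0.
Qed.

(** A cycle of the cone whose last component is a boundary is a boundary: once
    that boundary is subtracted, the first two components are cycles of [FA] and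
    [FB]. *)
Lemma cone_lift i (u1 : 'rV_(rk FA i)) (u2 : 'rV_(rk FB i)) (y : 'rV_(rk FC i)) :
    (u1 - y *m f i.+1) *m adiff FA i = 0 -> (u2 + y *m g i.+1) *m adiff FB i = 0 ->
  exists v : 'rV_(rk cone i.+1),
    row_mx (row_mx u1 u2) (y *m cone_diff i) = v *m diff cone i.
Proof.
move=> /(res_exact resA)[x1 x1E] /(res_exact resB)[x2 x2E].
exists (row_mx (row_mx x1 x2) y); rewrite cone_diffE.
by rewrite -[x1 *m _]x1E -[x2 *m _]x2E subrK addrK.
Qed.

(** The cone of [FC -> FA + FB], [w |-> (w f, - w g)], resolves the sum of the
    two ideals: exactness follows from the Mayer-Vietoris sequence
    [0 -> A :&: B -> A (+) B -> A + B -> 0]. *)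
Lemma cone_resolution :
  graded_resolution cone (fun p => exists a b, [/\ A a, B b & p = a + b]).
Proof.
split.
- case=> [|i] /=.
    apply: col_mx_graded; [apply: col_mx_graded|].
    + exact: (res_graded resA (i := 0%N)).
    + exact: (res_graded resB (i := 0%N)).
    + exact: mx0_graded.
  apply: col_mx_graded; apply: row_mx_graded.
  + apply: col_mx_graded; apply: row_mx_graded; try exact: mx0_graded.
      exact: (res_graded resA (i := i.+1)).
    exact: (res_graded resB (i := i.+1)).
  + exact: mx0_graded.
  + apply: row_mx_graded; first exact: (fg (i:=i.+1)).
    by apply: mxN_graded; exact: (gg (i:=i.+1)).
  + case: i => [|i]; first exact: mx0_graded.
    by apply: mxN_graded; exact: (res_graded resC (i := i.+1)).
- move=> p; split=> [[a [b [/(res_image resA)[u uE] /(res_image resB)[v vE] ->]]]|[v]].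
    exists (row_mx (row_mx u v) 0); rewrite cone_augE uE vE.
    by rewrite raddfD.
  rewrite -[v]hsubmxK -[lsubmx v]hsubmxK cone_augE => vE.
  exists ((lsubmx (lsubmx v) *m aug FA) 0 0), ((rsubmx (lsubmx v) *m aug FB) 0 0).
  split.
  + by apply/(res_image resA); eexists; apply: mx11_scalar.
  + by apply/(res_image resB); eexists; apply: mx11_scalar.
  + by move/matrixP/(_ 0 0): vE; rewrite !mxE eqxx mulr1n => <-.
- have fdA i : f i.+2 *m diff FA i = diff FC i *m f i.+1 by rewrite (fE i.+1).
  have gdB i : g i.+2 *m diff FB i = diff FC i *m g i.+1 by rewrite (gE i.+1).
  case=> [|i] v; rewrite -[v]hsubmxK -[lsubmx v]hsubmxK.
    set u1 := lsubmx _; set u2 := rsubmx (lsubmx v); rewrite [rsubmx v]thinmx0.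
    split=> [|[w]].
      rewrite [_ *m _]cone_augE => uE.
      have [y yE] : exists y : 'rV_(rk FC 0), y *m aug FC = u1 *m aug FA.
        rewrite [u1 *m _]mx11_scalar; apply/(res_image resC); split.
          by apply/(res_image resA); exists u1; rewrite -mx11_scalar.
        apply/(res_image resB); exists (- u2); rewrite -mx11_scalar mulNmx.
        by apply/esym/eqP; rewrite -addr_eq0 uE.
      have [||v' v'E] := @cone_lift 0%N u1 u2 y.
      + by rewrite mulmxBl -mulmxA -fE f0 mulmx1 [adiff _ _]/(aug _) yE subrr.
      + by rewrite mulmxDl -mulmxA -gE g0 mulmx1 /= yE addrC uE.
      by exists v'; rewrite -[RHS]v'E [_ *m cone_diff 0]thinmx0.
    rewrite -[w]hsubmxK -[lsubmx w]hsubmxK [_ *m adiff _ _]cone_diffE => ->.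
    rewrite [_ *m _]cone_augE !mulmxDl mulNmx -!mulmxA -(fE 0%N) -(gE 0%N) f0 g0 !mulmx1.
    rewrite (adiff_comp 0 resA) (adiff_comp 0 resB) !mulmx0 !add0r; exact: subrr.
  set u1 := lsubmx _; set u2 := rsubmx (lsubmx v); set w := rsubmx v.
  have diffE := @cone_diffE i u1 u2 w.
  split=> [|[w']].
    rewrite [_ *m _]diffE => /eqP; rewrite !row_mx_eq0 => /andP[/andP[/eqP u1E /eqP u2E] /eqP wE].
    have [y yE] := (res_exact resC _).1 (cone_cycle u1E wE).
    have [||v' v'E] := @cone_lift i.+1 u1 u2 (- y).
    + by rewrite mulmxBl !mulNmx opprK /= -mulmxA fdA mulmxA -[y *m _]yE.
    + by rewrite mulmxDl !mulNmx /= -mulmxA gdB mulmxA -[y *m _]yE.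
    by exists v'; rewrite -[RHS]v'E /= mulmxN mulNmx opprK -[y *m _]yE.
  rewrite -[w']hsubmxK -[lsubmx w']hsubmxK [_ *m adiff _ _]cone_diffE.
  move=> /eq_row_mx[/eq_row_mx[-> ->] ->].
  rewrite [_ *m _]cone_diffE /= !mulmxN !mulNmx -!mulmxA cone_diff_comp.
  have dA := adiff_comp i.+1 resA; have dB := adiff_comp i.+1 resB; rewrite /= in dA dB.
  rewrite mulmxDl mulmxBl -!mulmxA dA dB fdA gdB !mulmx0 !add0r opprK subrr addNr oppr0.
  by rewrite !row_mx0.
Qed.

End Cone.

(** The intersection is allowed one degree more, since the cone places its
    resolution one step further. *)
Lemma reg_le_sum (A B I : S -> Prop) (r : int) :
    reg_le A r -> reg_le B r -> reg_le (fun p => A p /\ B p) (r + 1) ->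
    same_set (fun p => exists a b, [/\ A a, B b & p = a + b]) I ->
  reg_le I r.
Proof.
move=> [FA resA leA] [FB resB leB] [FC resC leC] defI.
have [f [f0 fg fE]] := chain_lift resC resA (fun p (h : A p /\ B p) => h.1).
have [g [g0 gg gE]] := chain_lift resC resB (fun p (h : A p /\ B p) => h.2).
exists (cone f g).
  exact: eq_graded_resolution defI (cone_resolution resA resB resC f0 g0 fg gg fE gE).
move=> i; apply: sum_shift_le; first by apply: sum_shift_le; [exact: leA | exact: leB].
case: i => [|i] /= a; first by case: a.
by have := leC i a; rewrite -addrA -PoszD add1n.
Qed.

End MayerVietoris.

(** * Finite generation over the polynomial ring *)

Section Noetherian.
Variables (K : fieldType) (n : nat).
Local Notation S := {mpoly K[n]}.

(** Dickson's lemma: every set of monomials has finitely many members such that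
    each member is divisible by one of them. The induction is on the number [j] of variables in which
    divisibility is required. *)
Lemma dickson (A : 'X_{1..n} -> Prop) :
  exists s : seq 'X_{1..n}, (forall b, b \in s -> A b) /\
    forall a, A a -> exists2 b, b \in s & (b <= a)%MM.
Proof.
suff dick (j : nat) (B : 'X_{1..n} -> Prop) : exists s : seq 'X_{1..n},
    (forall b, b \in s -> B b) /\
    forall a, B a -> exists2 b, b \in s & forall i : 'I_n, (i < j)%N -> (b i <= a i)%N.
  have [s [sA sle]] := dick n A; exists s; split=> // a /sle[b bs ba].
  by exists b => //; apply/mnm_lepP => i; apply: ba.
elim: j B => [|j IH] B.
  have [[b Bb]|noB] := classic (exists b, B b).
    by exists [:: b]; split=> [a|a _]; [rewrite inE => /eqP-> | exists b; rewrite ?mem_head].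
  by exists [::]; split=> // a Ba; case: noB; exists a.
have [jn|nj] := ltnP j n; last first.
  have [s [sB sle]] := IH B; exists s; split=> // a /sle[b bs ba]; exists b => // i _.
  by apply: ba; apply: leq_trans nj.
pose j' := Ordinal jn; have [s [sB sle]] := IH B.
(* Monomials whose exponent of the new variable is at least [M] are above one of
   [s]; the others are treated separately for each of the [M] exponents. *)
pose M := \max_(b <- s) b j'.
have [t ht] := fin_all_exists (fun c : 'I_M => IH (fun a => B a /\ a j' = c :> nat)).
exists (s ++ flatten [seq t c | c <- enum 'I_M]); split.
  move=> b; rewrite mem_cat => /orP[/sB //|/flatten_mapP[c _ bt]].
  by have [/(_ _ bt)[]] := ht c.
move=> a Ba; have [lt|ge] := ltnP (a j') M.
  have [_ /(_ a (conj Ba erefl))[b bt ba]] := ht (Ordinal lt).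
  have [/(_ _ bt)[_ bj] _] := ht (Ordinal lt).
  exists b.
    rewrite mem_cat; apply/orP; right; apply/flatten_mapP.
    by exists (Ordinal lt); rewrite ?mem_enum.
  move=> i; rewrite ltnS leq_eqVlt => /orP[/eqP ij|/ba //].
  by have -> : i = j' by [apply: val_inj]; rewrite bj.
have [b bs ba] := sle a Ba; exists b; first by rewrite mem_cat bs.
move=> i; rewrite ltnS leq_eqVlt => /orP[/eqP ij|/ba //].
have -> : i = j' by apply: val_inj.
by apply: leq_trans ge; exact: (@leq_bigmax_seq _ s xpredT (fun b : 'X_{1..n} => b j') b bs).
Qed.

Record submodule r (N : 'rV[S]_r -> Prop) : Prop := Submodule {
  submodule0 : N 0;
  submoduleD : forall u v, N u -> N v -> N (u + v);
  submoduleZ : forall p u, N u -> N (p *: u) }.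

Definition generates s r (G : 'M[S]_(s, r)) (N : 'rV[S]_r -> Prop) :=
  forall v, N v <-> exists w : 'rV_s, v = w *m G.

Lemma submodule_sum r (N : 'rV[S]_r -> Prop) (I : Type) (s : seq I) (P : pred I) (v : I -> 'rV_r) :
  submodule N -> (forall i, P i -> N (v i)) -> N (\sum_(i <- s | P i) v i).
Proof. by case=> N0 ND _ h; elim/big_ind: _. Qed.

Lemma submodule_mul s r (N : 'rV[S]_r -> Prop) (G : 'M_(s, r)) (w : 'rV_s) :
  submodule N -> (forall i, N (row i G)) -> N (w *m G).
Proof.
move=> sN h; rewrite mulmx_sum_row; apply: submodule_sum => // i _.
exact: submoduleZ.
Qed.

Lemma span_submodule s r (G : 'M[S]_(s, r)) : submodule (fun v => exists w : 'rV_s, v = w *m G).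
Proof.
split=> [|u v [w ->] [w' ->]|p u [w ->]].
- by exists 0; rewrite mul0mx.
- by exists (w + w'); rewrite mulmxDl.
- by exists (p *: w); rewrite scalemxAl.
Qed.

(** Hilbert's basis theorem: by Dickson's lemma finitely many elements have
    leading monomials dividing all leading monomials of the ideal, and division
    by them strictly decreases the leading monomial. *)
Lemma ideal_finitely_generated (I : 'rV[S]_1 -> Prop) : submodule I ->
  exists t (G : 'M[S]_(t, 1)), generates G I.
Proof.
move=> sI.
pose lead a := exists v, [/\ I v, v 0 0 != 0 & mlead (v 0 0) = a].
have [s [s_lead s_le]] := dickson lead.
have [g hg] := fin_all_exists (fun i : 'I_(size s) => s_lead _ (mem_nth 0%MM (ltn_ord i))).
exists (size s), (\matrix_i g i) => v; split; last first.
  by case=> w ->; apply: submodule_mul => // i; rewrite rowK; case: (hg i).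
elim/(well_founded_ind (@ltom_wf n)): {v}(mlead (v 0 0)) {-2}v (erefl (mlead (v 0 0))).
move=> a IH v aE Iv.
have [v0|nz] := eqVneq (v 0 0) 0.
  by exists 0; rewrite mul0mx; apply/matrixP => i j; rewrite !ord1 v0 mxE.
have [b bs ba] : exists2 b, b \in s & (b <= mlead (v 0%R 0%R))%MM by apply: s_le; exists v.
pose i := Ordinal (etrans (index_mem b s) bs : (index b s < size s)%N).
have [Ig gnz glead] := hg i; rewrite /= nth_index // in glead.
pose c := (mleadc (v 0 0) / mleadc (g i 0 0)) *: 'X_[mlead (v 0 0) - b].
pose q := v - c *: g i.
have Iq : I q by apply: submoduleD => //; rewrite -scaleNr; apply: submoduleZ.
have q00 : q 0 0 = v 0 0 - c * g i 0 0 by rewrite !mxE.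
have lead_cg : mlead (c * g i 0 0) = mlead (v 0 0).
  have cnz : mleadc (v 0 0) / mleadc (g i 0 0) != 0.
    by rewrite mulf_neq0 ?invr_eq0 ?mleadc_eq0.
  rewrite mleadM // ?mleadZ // ?mleadXm ?glead ?submK // /c scaler_eq0 negb_or cnz.
  by rewrite -msupp_eq0 msuppX.
have coef0 : (q 0 0)@_(mlead (v 0 0)) = 0.
  rewrite q00 mcoeffB /c -scalerAl mcoeffZ -commr_mpolyX.
  rewrite -[X in (g i 0 0 * _)@_X](submK ba) mcoeffMX -glead divfK ?mleadc_eq0 //.
  exact: subrr.
have [qz|qnz] := eqVneq (q 0 0) 0.
  exists (c *: delta_mx 0 i); rewrite -scalemxAl -rowE rowK.
  apply/matrixP => x y; rewrite !ord1; move/eqP: qz.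
  by rewrite q00 subr_eq0 => /eqP ->; rewrite mxE.
have lt_q : (mlead (q 0 0) < a)%O.
  rewrite -aE lt_neqAle; apply/andP; split.
    by apply: contra_eq_neq coef0 => <-; rewrite mleadc_eq0.
  by rewrite q00 (le_trans (mleadB_le _ _)) // lead_cg joinxx.
have [w wE] := IH _ lt_q q erefl Iq.
exists (w + c *: delta_mx 0 i); rewrite mulmxDl -wE -scalemxAl -rowE rowK.
by rewrite /q subrK.
Qed.

(** Submodules of a free module of finite rank: split off the first coordinate,
    whose values form an ideal. *)
Lemma finitely_generated r (N : 'rV[S]_r -> Prop) : submodule N ->
  exists s (G : 'M[S]_(s, r)), generates G N.
Proof.
elim: r N => [|r IH] N sN.
  exists 0%N, 0 => v; split=> [_|_]; first by exists 0; apply/matrixP => i [].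
  by rewrite thinmx0; case: sN.
rewrite -[r.+1]/(1 + r)%N in N sN *.
pose N1 (u : 'rV[S]_1) := exists v : 'rV[S]_r, N (row_mx u v).
have sN1 : submodule N1.
  split=> [|u u' [v Nv] [v' Nv']|p u [v Nv]].
  - by exists 0; rewrite row_mx0; case: sN.
  - by exists (v + v'); rewrite -add_row_mx; case: sN => _ h _; apply: h.
  - by exists (p *: v); rewrite -scale_row_mx; case: sN => _ _; apply.
pose N2 (v : 'rV[S]_r) := N (row_mx (0 : 'rV_1) v).
have sN2 : submodule N2.
  split=> [|v v' Nv Nv'|p v Nv].
  - by rewrite /N2 row_mx0; case: sN.
  - by rewrite /N2 -[0]addr0 -add_row_mx; case: sN => _ h _; apply: h.
  - by rewrite /N2 -(scaler0 _ p) -scale_row_mx; case: sN => _ _; apply.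
have [s1 [G1 gen1]] := ideal_finitely_generated sN1.
have [s2 [G2 gen2]] := IH N2 sN2.
have [v hv] : exists v : 'I_s1 -> 'rV[S]_r, forall i, N (row_mx (row i G1) (v i)).
  have rowN1 i : N1 (row i G1) by apply/gen1; exists (delta_mx 0 i); rewrite -rowE.
  exact: fin_all_exists rowN1.
pose V := \matrix_i v i.
pose G : 'M[S]_(s1 + s2, 1 + r) := block_mx G1 V 0 G2.
have NG i : N (row i G : 'rV_(1 + r)).
  rewrite /G block_mxEv; have [j ->|j ->] := split_ordP i.
    by rewrite rowKu row_row_mx rowK.
  by rewrite rowKd row_row_mx row0 -/(N2 _); apply/gen2; exists (delta_mx 0 j); rewrite -rowE.
exists (s1 + s2)%N, G => x; split=> [|[w ->]]; last by apply: submodule_mul.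
rewrite -[x]hsubmxK => Nx.
have [w1 w1E] := (gen1 (lsubmx x)).1 (ex_intro _ _ Nx).
have Nw1 : N (row_mx (w1 *m G1) (w1 *m V)).
  rewrite -mul_mx_row; apply: submodule_mul => // i.
  by rewrite row_row_mx rowK.
have /gen2[w2 w2E] : N2 (rsubmx x - w1 *m V).
  rewrite /N2 -(subrr (w1 *m G1)) -add_row_mx -opp_row_mx -w1E.
  case: sN => _ ND NZ; apply: ND => //; rewrite -scaleN1r w1E; exact: NZ.
exists (row_mx w1 w2); rewrite /G mul_row_block mulmx0 addr0 -w2E -w1E.
by rewrite addrC subrK.
Qed.

End Noetherian.

(** * Existence of minimal graded resolutions *)

Section MinimalResolution.
Variables (K : fieldType) (n : nat).
Local Notation S := {mpoly K[n]}.

Definition graded_submodule r (sh : 'I_r -> int) (N : 'rV[S]_r -> Prop) :=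
  forall z v, N v -> N (mx_hcomp (fun=> z) sh v).

Definition graded_generates s r (sh' : 'I_s -> int) (sh : 'I_r -> int)
    (G : 'M[S]_(s, r)) N := mx_graded sh' sh G /\ generates G N.

Lemma sum_components r (sh : 'I_r -> int) (v : 'rV[S]_r) :
  exists l : seq int, v = \sum_(z <- l) mx_hcomp (fun=> z) sh v.
Proof.
exists (undup (flatten [seq [seq (mdeg m)%:Z + sh a | m <- msupp (v 0 a)] | a <- enum 'I_r])).
set l := undup _; apply/matrixP => i a; rewrite ord1 summxE; apply/mpolyP => m.
rewrite (raddf_sum (mcoeff m)) /=.
under eq_bigr => z _ do rewrite mxE mcoeff_hcomp.
have [mv|/memN_msupp_eq0 ->] := boolP (m \in msupp (v 0 a)); last first.
  by rewrite big1 // => z _; rewrite mul0rn.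
have zl : (mdeg m)%:Z + sh a \in l.
  by rewrite mem_undup; apply/flatten_mapP; exists a; rewrite ?mem_enum //; apply: map_f.
rewrite (bigD1_seq _ zl) ?undup_uniq //= addrK eqxx mulr1n big1 ?addr0 // => z ne.
rewrite [_ == _](_ : _ = false) ?mulr0n //; apply: contraNF ne => /eqP ->.
by rewrite subrK.
Qed.

(** The homogeneous components of a finite set of generators generate too. *)
Lemma graded_generators r (sh : 'I_r -> int) (N : 'rV[S]_r -> Prop) :
    submodule N -> graded_submodule sh N ->
  exists s (sh' : 'I_s -> int) (G : 'M[S]_(s, r)), graded_generates sh' sh G N.
Proof.
move=> sN gN; have [s [G gen]] := finitely_generated sN.
have [l hl] := fin_all_exists (fun i => sum_components sh (row i G)).
pose L := flatten [seq [seq (z, mx_hcomp (fun=> z) sh (row i G)) | z <- l i] | i <- enum 'I_s].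
pose G' := \matrix_(k < size L) (nth (0, 0) L k).2.
exists (size L), (fun k => (nth (0, 0) L k).1), G'.
have memL (k : 'I_(size L)) : exists z i, nth (0, 0) L k = (z, mx_hcomp (fun=> z) sh (row i G)).
  by have /flatten_mapP[i _ /mapP[z _ ->]] := mem_nth (0, 0) (ltn_ord k); exists z, i.
split=> [k a|v].
  by rewrite mxE; have [z [i ->]] := memL k; exact: mx_hcomp_graded.
split=> [/gen[w ->]|[w ->]]; last first.
  apply: submodule_mul => // k; rewrite rowK; have [z [i ->]] := memL k; apply: gN.
  by apply/gen; exists (delta_mx 0 i); rewrite -rowE.
apply: (submodule_mul w (span_submodule G')) => i.
rewrite hl big_seq; apply: (submodule_sum _ (span_submodule G')) => z zl.
have kL : (z, mx_hcomp (fun=> z) sh (row i G)) \in L.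
  by apply/flatten_mapP; exists i; rewrite ?mem_enum //; apply: map_f.
rewrite -index_mem in kL; exists (delta_mx 0 (Ordinal kL)).
by rewrite -rowE rowK /= nth_index // -index_mem.
Qed.

(** Nakayama's lemma in graded form: in a homogeneous generating family with the
    least number of members, no relation has a coefficient with a constant term,
    since the component of the relation in the degree of that generator would
    express it by the others. *)
Lemma minimal_graded_generators r (sh : 'I_r -> int) (N : 'rV[S]_r -> Prop) :
    submodule N -> graded_submodule sh N ->
  exists s (sh' : 'I_s -> int) (G : 'M[S]_(s, r)), graded_generates sh' sh G N /\
    forall w : 'rV[S]_s, w *m G = 0 -> const_part w = 0.
Proof.
move=> sN gN.
pose P s := exists (sh' : 'I_s -> int) (G : 'M[S]_(s, r)), graded_generates sh' sh G N.
have [s [Ps mins]] : exists s, P s /\ forall t, P t -> (s <= t)%N.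
  have [s0 Ps0] := graded_generators sN gN; apply: NNPP => none.
  suff h s : ~ P s by case: (h s0).
  elim/ltn_ind: s => s IH Ps; apply: none; exists s; split=> // t Pt.
  by rewrite leqNgt; apply/negP => /IH.
case: Ps => sh' [G [Gg gen]]; exists s, sh', G; split=> // w wG.
apply/rowP => b; rewrite !mxE; apply/eqP/negPn/negP => cnz.
case: s mins sh' G Gg gen w wG b cnz => [|s] mins sh' G Gg gen w wG b cnz.
  by case: (b).
pose w' := mx_hcomp (fun=> sh' b) sh' w.
have w'G : w' *m G = 0.
  rewrite -(mx_hcompM _ _ Gg) wG; apply/matrixP => i j; rewrite !mxE.
  by apply: hcomp_id; apply: homog_deg0.
pose c := (w 0 b)@_0%MM.
have w'b : w' 0 b = c%:MP.
  rewrite mxE subrr; apply/mpolyP => m; rewrite mcoeff_hcomp mcoeffC /c eqz_nat mdeg_eq0.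
  by case: eqP => [->|]; rewrite ?mulr1 ?mulr0.
suff : P s by move/mins; rewrite ltnn.
exists (fun a => sh' (lift b a)), (row' b G); split; first by move=> i j; rewrite mxE.
move=> v; split=> [/gen[u vE]|[u ->]]; last first.
  apply: submodule_mul => // i; apply/gen; exists (delta_mx 0 (lift b i)).
  by rewrite -rowE; apply/rowP => j; rewrite !mxE.
pose u' := u - (c^-1%:MP * u 0 b) *: w'.
have u'b : u' 0 b = 0.
  rewrite mxE [X in _ + X]mxE [X in _ - X]mxE w'b mulrC mulrA -mpolyCM mulfV // mul1r.
  exact: subrr.
exists (col' b u'); have -> : v = u' *m G by rewrite mulmxBl -scalemxAl w'G scaler0 subr0.
apply/rowP => j; rewrite !mxE (bigD1_ord b) //= u'b mul0r add0r.
by apply: eq_bigr => i _; rewrite !mxE.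
Qed.

(** A stage of the construction of a minimal resolution: one differential with
    the shifts of its source and target. The target of [next_stage] is
    definitionally the source of the previous stage, so that the iterates fit
    together into a sequence of maps. *)
Record stage := Stage {
  st_src : nat; st_tgt : nat;
  st_sh : 'I_st_src -> int; st_sh' : 'I_st_tgt -> int;
  st_mx : 'M[S]_(st_src, st_tgt) }.

Definition good_stage st := mx_graded (@st_sh st) (@st_sh' st) (st_mx st) /\
  forall w : 'rV_(st_src st), w *m st_mx st = 0 -> const_part w = 0.

(** The implication makes the choice total, so that [next_stage] can be defined
    on all stages. *)
Lemma next_stage_ex st : exists x : {t & (('I_t -> int) * 'M[S]_(t, st_src st))%type},
  good_stage st -> good_stage (Stage (projT2 x).1 (@st_sh st) (projT2 x).2) /\
    generates (projT2 x).2 (fun v => v *m st_mx st = 0).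
Proof.
have [[gst _]|bad] := classic (good_stage st); last by exists (existT _ 0%N (fun=> 0, 0)).
have sN : submodule (fun v => v *m st_mx st = 0).
  split=> [|u v u0 v0|p u u0]; first by rewrite mul0mx.
    by rewrite mulmxDl u0 v0 addr0.
  by rewrite -scalemxAl u0 scaler0.
have gN : graded_submodule (@st_sh st) (fun v => v *m st_mx st = 0).
  move=> z v v0; rewrite -(mx_hcompM _ _ gst) v0; apply/matrixP => i j.
  by rewrite !mxE; apply: hcomp_id; apply: homog_deg0.
have [t [sh [G [[Gg gen] Gmin]]]] := minimal_graded_generators sN gN.
by exists (existT _ t (sh, G)).
Qed.

Definition next_stage st : stage :=
  let x := proj1_sig (constructive_indefinite_description _ (next_stage_ex st)) in
  Stage (projT2 x).1 (@st_sh st) (projT2 x).2.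

Lemma next_stageP st : good_stage st -> good_stage (next_stage st) /\
  generates (st_mx (next_stage st) : 'M_(_, st_src st)) (fun v => v *m st_mx st = 0).
Proof. by rewrite /next_stage; case: constructive_indefinite_description. Qed.

(** Resolve by minimal generators, then by minimal generators of the successive
    kernels. *)
Lemma min_resolution_exists (I : S -> Prop) :
    I 0 -> (forall p q, I p -> I q -> I (p + q)) -> (forall p q, I q -> I (p * q)) ->
    (forall z p, I p -> I (hcomp z p)) ->
  exists F, min_graded_free_resolution F I.
Proof.
move=> I0 ID IM Ih.
have sN : submodule (fun v : 'rV[S]_1 => I (v 0 0)).
  by split=> [|u v Iu Iv|p u Iu]; rewrite mxE; [|exact: ID|exact: IM].
have gN : graded_submodule (fun=> 0) (fun v : 'rV[S]_1 => I (v 0 0)).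
  by move=> z v Iv; rewrite mxE; apply: Ih.
have [s [sh [G [[Gg gen] Gmin]]]] := minimal_graded_generators sN gN.
pose st i := iter i next_stage (Stage sh (fun=> 0) G).
have good i : good_stage (st i) by elim: i => [|i IHi]; [split | case: (next_stageP IHi)].
pose F := {|
  rk := fun i => st_src (st i); shift := fun i => @st_sh (st i);
  diff := fun i => st_mx (st i.+1); aug := G |}.
have exF i (v : 'rV_(rk F i)) :
    v *m st_mx (st i) = 0 <-> exists w : 'rV_(rk F i.+1), v = w *m diff F i.
  by have [_] := next_stageP (good i); apply.
exists F; apply: graded_resolution_min; first split.
- by case=> [|i] b a; [exact: Gg | case: (good i.+1) => h _; exact: h].
- move=> p; split=> [Ip|[v vE]].
    have [w wE] : exists w, p%:M = w *m G by apply/gen; rewrite mxE eqxx.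
    by exists w.
  have -> : p = (p%:M : 'M_1) 0 0 by rewrite mxE eqxx.
  by rewrite -vE; apply/gen; exists v.
- by case=> [|i] v; [exact: (exF 0%N v) | exact: (exF i.+1 v)].
move=> i; apply/row_matrixP => b; rewrite row0 -map_row.
have [_ cmin] := good i; apply: cmin.
by apply/exF; exists (delta_mx 0 b); rewrite -rowE.
Qed.

End MinimalResolution.

(** * Monomial ideals and their regularity *)

Section MonomialIdeals.
Variables (K : fieldType) (n : nat).
Local Notation S := {mpoly K[n]}.
Implicit Types (M : 'X_{1..n} -> Prop) (p q : S).

Definition upset M := forall a b, M a -> (a <= b)%MM -> M b.

Definition monomials_in M p : Prop := forall m, m \in msupp p -> M m.

Definition minimal_in M m := M m /\ forall a, M a -> (a <= m)%MM -> a = m.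

Lemma monomials_in0 M : monomials_in M 0.
Proof. by move=> m; rewrite msupp0. Qed.

Lemma monomials_inD M p q : monomials_in M p -> monomials_in M q -> monomials_in M (p + q).
Proof. by move=> hp hq m /msuppD_le; rewrite mem_cat => /orP[/hp|/hq]. Qed.

Lemma monomials_inM M p q : upset M -> monomials_in M q -> monomials_in M (p * q).
Proof.
move=> uM hq m /msuppM_le/allpairsP[[m1 m2] /= [_ /hq Mm2 ->]].
exact: uM Mm2 (lem_addl _ _).
Qed.

Lemma monomials_in_hcomp M z p : monomials_in M p -> monomials_in M (hcomp z p).
Proof.
move=> h m; rewrite mcoeff_msupp mcoeff_hcomp => nz; apply: h; rewrite mcoeff_msupp.
by apply: contraNneq nz => ->; rewrite mul0rn.
Qed.

Lemma monomials_inX M m : monomials_in M 'X_[m] <-> M m.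
Proof.
split=> [|Mm m']; first by apply; rewrite msuppX mem_head.
by rewrite msuppX inE => /eqP ->.
Qed.

Lemma ideal_gen0 (A : S -> Prop) : ideal_gen A 0.
Proof. by exists [::]; split=> //; rewrite big_nil. Qed.

Lemma ideal_genD (A : S -> Prop) p q : ideal_gen A p -> ideal_gen A q -> ideal_gen A (p + q).
Proof.
move=> [s [sA ->]] [t [tA ->]]; exists (s ++ t); split; last by rewrite big_cat.
by move=> x; rewrite mem_cat => /orP[/sA|/tA].
Qed.

Lemma ideal_gen_multiple (A : S -> Prop) p q : A q -> ideal_gen A (p * q).
Proof. by move=> Aq; exists [:: (p, q)]; rewrite big_seq1; split=> // x; rewrite inE => /eqP ->. Qed.

(** A generating set whose members only involve monomials of [M], and which
    reaches every monomial of [M], generates the monomial ideal of [M]. *)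
Lemma ideal_gen_monomials_in (A : S -> Prop) M : upset M ->
    (forall q, A q -> monomials_in M q) ->
    (forall m, M m -> exists2 q, A q & exists p, 'X_[m] = p * q) ->
  same_set (ideal_gen A) (monomials_in M).
Proof.
move=> uM AM MA p; split=> [[s [sA ->]]|Mp].
  rewrite big_seq; elim/big_ind: _ => [|x y|x /sA/AM Mx].
  - exact: monomials_in0.
  - exact: monomials_inD.
  - exact: monomials_inM.
rewrite [p]mpolyE big_seq; elim/big_ind: _ => [|x y|m /Mp/MA[q Aq [r ->]]].
- exact: ideal_gen0.
- exact: ideal_genD.
- by rewrite scalerAl; apply: ideal_gen_multiple.
Qed.

Lemma upset_pair_ge (i j : 'I_n) k : upset (fun m => (k <= m i + m j)%N).
Proof. by move=> a b ka /mnm_lepP ab; rewrite (leq_trans ka) // leq_add. Qed.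

Lemma monomial_split (m : 'X_{1..n}) i : (0 < m i)%N -> 'X_[m] = 'X_[m - U_(i)] * 'X_i :> S.
Proof. by move=> mi; rewrite -mpolyXD submK // lep1mP -lt0n. Qed.

Lemma edge_primeE (i j : 'I_n) :
  same_set (@edge_prime K n i j) (monomials_in (fun m => (1 <= m i + m j)%N)).
Proof.
apply: ideal_gen_monomials_in; first exact: upset_pair_ge.
  by move=> q [] ->; apply/monomials_inX; rewrite !mnm1E eqxx ?addn1.
move=> m; rewrite addn_gt0 => /orP[] /monomial_split ->.
  by exists 'X_i; [left | exists 'X_[m - U_(i)]].
by exists 'X_j; [right | exists 'X_[m - U_(j)]].
Qed.

Lemma edge_prime_powE (i j : 'I_n) k : i != j ->
  same_set (ideal_pow (@edge_prime K n i j) k) (monomials_in (fun m => (k <= m i + m j)%N)).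
Proof.
move=> ij; elim: k => [|k IH]; first by move=> p; split.
apply: ideal_gen_monomials_in; first exact: upset_pair_ge.
  move=> _ [a [b [/edge_primeE Ma /IH Mb ->]]] m.
  move=> /msuppM_le/allpairsP[[m1 m2] /= [/Ma h1 /Mb h2 ->]]; rewrite !mnmDE; lia.
have nji : j == i = false by rewrite eq_sym (negPf ij).
move=> m km; have : ((0 < m i) || (0 < m j))%N by lia.
move=> mij; exists 'X_[m]; last by exists 1; rewrite mul1r.
case/orP: mij => mi.
  exists 'X_i, 'X_[m - U_(i)]; split; last by rewrite mulrC -monomial_split.
    by apply/edge_primeE/monomials_inX; rewrite mnm1E eqxx.
  by apply/IH/monomials_inX; rewrite !mnmBE !mnm1E eqxx (negPf ij); lia.
exists 'X_j, 'X_[m - U_(j)]; split; last by rewrite mulrC -monomial_split.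
  by apply/edge_primeE/monomials_inX; rewrite !mnm1E eqxx addn1.
by apply/IH/monomials_inX; rewrite !mnmBE !mnm1E eqxx nji; lia.
Qed.

(** The [k]-covers of the graph, in the sense of vertex weights, that are bounded
    below by [l]; for [l = 0] they are the exponents of the monomials in the [k]-th
    symbolic power. The bound [l] is the state of the induction on which the regularity
    estimate rests. *)
Definition kcover (e : rel 'I_n) k (l a : 'X_{1..n}) : Prop :=
  (l <= a)%MM /\ forall i j, e i j -> (k <= a i + a j)%N.

Lemma upset_kcover e k l : upset (kcover e k l).
Proof.
move=> a b [la ka] ab; split=> [|i j ij]; first exact: lepm_trans la ab.
by rewrite (leq_trans (ka i j ij)) //; move/mnm_lepP: ab => ab; rewrite leq_add.
Qed.

Lemma le0mnm (m : 'X_{1..n}) : (0%MM <= m)%MM.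
Proof. by apply/mnm_lepP => i; rewrite mnm0E. Qed.

Lemma symbolic_powerE e k : irreflexive e ->
  same_set (@symbolic_power K n e k) (monomials_in (kcover e k 0%MM)).
Proof.
move=> irr p; have ne i j : e i j -> i != j by move=> ij; apply: contraTneq ij => ->; rewrite irr.
split=> [h m mp|h i j ij].
  split=> [|i j ij]; first exact: le0mnm.
  exact: ((edge_prime_powE k (ne _ _ ij)) p).1 (h i j ij) m mp.
by apply/(edge_prime_powE k (ne _ _ ij)) => m /h[_]; apply.
Qed.

Lemma cover_idealE e :
  same_set (@cover_ideal K n e) (monomials_in (kcover e 1 0%MM)).
Proof.
move=> p; split=> [h m mp|h i j ij].
  split=> [|i j ij]; first exact: le0mnm.
  exact: ((edge_primeE i j) p).1 (h i j ij) m mp.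
by apply/edge_primeE => m /h[_]; apply.
Qed.

Lemma minimal_below M m : M m -> exists2 a, minimal_in M a & (a <= m)%MM.
Proof.
have [d] := ubnP (mdeg m); elim: d m => // d IH m md Mm.
have [mm|] := classic (minimal_in M m); first by exists m => //; exact: lepm_refl.
move=> nmin; have [a [Ma am ne]] : exists a, [/\ M a, (a <= m)%MM & a <> m].
  apply: NNPP => none; apply: nmin; split=> // a Ma am; apply: NNPP => ne.
  by apply: none; exists a.
have lt : (mdeg a < mdeg m)%N.
  rewrite -[in mdeg m](submK am) mdegD -{1}[mdeg a]add0n ltn_add2r lt0n mdeg_eq0.
  by apply/eqP => e0; apply: ne; rewrite -[RHS](submK am) e0 add0m.
have [b bmin ba] := IH a (leq_trans lt md) Ma.
by exists b => //; apply: lepm_trans ba am.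
Qed.

Lemma same_set_sym (I J : S -> Prop) : same_set I J -> same_set J I.
Proof. by move=> IJ p; rewrite IJ. Qed.

Lemma eq_min_monomial_generators (I J : S -> Prop) A : same_set I J ->
  min_monomial_generators I A -> min_monomial_generators J A.
Proof.
move=> IJ [genA minA]; split=> [p|B BA genB m Am]; first by rewrite genA IJ.
by apply: minA m Am => // p; rewrite genB IJ.
Qed.

Lemma monomial_ideal_genE (A : 'X_{1..n} -> Prop) :
  same_set (@monomial_ideal_gen K n A) (monomials_in (fun m => exists2 a, A a & (a <= m)%MM)).
Proof.
apply: ideal_gen_monomials_in.
- by move=> a b [c Ac ca] ab; exists c => //; apply: lepm_trans ca ab.
- by move=> _ [m [Am ->]]; apply/monomials_inX; exists m => //; exact: lepm_refl.
move=> m [a Aa am]; exists 'X_[a]; first by exists a.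
by exists 'X_[m - a]; rewrite -mpolyXD submK.
Qed.

Lemma monomials_in_genE M (A : 'X_{1..n} -> Prop) :
  same_set (@monomial_ideal_gen K n A) (monomials_in M) ->
  forall m, M m <-> exists2 a, A a & (a <= m)%MM.
Proof.
move=> h m; pose N m := exists2 a, A a & (a <= m)%MM.
split=> [Mm|Am].
  by apply/(monomials_inX N m)/monomial_ideal_genE/h/monomials_inX.
by apply/(monomials_inX M m)/h/monomial_ideal_genE/monomials_inX.
Qed.

Lemma minimal_generatorsP M : upset M ->
  min_monomial_generators (@monomials_in M) (minimal_in M).
Proof.
move=> uM; have gen m : M m <-> exists2 a, minimal_in M a & (a <= m)%MM.
  by split=> [/minimal_below//|[a [Ma _] am]]; exact: uM Ma am.
split=> [p|B BA genB m [Mm mmin]].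
  split=> [/monomial_ideal_genE h m /h/gen //|h]; apply/monomial_ideal_genE => m /h.
  by move/gen.
have [a Ba am] := (monomials_in_genE genB m).1 Mm.
by rewrite -(mmin a _ am) //; case: (BA a Ba).
Qed.

Lemma minimal_generator_minimal M A m :
  min_monomial_generators (monomials_in M) A -> A m -> minimal_in M m.
Proof.
move=> [genA Amin] Am; have hA := monomials_in_genE genA.
have Mm : M m by apply/hA; exists m => //; exact: lepm_refl.
split=> // a Ma am; apply: NNPP => ne.
pose B b := A b /\ b <> m.
suff genB : same_set (@monomial_ideal_gen K n B) (monomials_in M).
  by have [] := Amin B (fun b (Bb : B b) => Bb.1) genB m Am.
have below b : M b -> exists2 c, B c & (c <= b)%MM.
  move=> /hA[c Ac cb]; have [cm|] := classic (c = m); last by exists c.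
  have [c' Ac' c'a] := (hA a).1 Ma; exists c'; last first.
    by apply: lepm_trans cb; rewrite cm; apply: lepm_trans am.
  split=> // c'm; apply: ne; apply/mnmP => i; apply/eqP.
  by rewrite eqn_leq (mnm_lepP am) -c'm (mnm_lepP c'a).
move=> p; split=> [/monomial_ideal_genE h b /h[c [Ac _] cb]|h].
  by apply/hA; exists c.
by apply/monomial_ideal_genE => b /h/below.
Qed.

Lemma eq_regularity (I J : S -> Prop) (r : int) :
  same_set I J -> regularity I r -> regularity J r.
Proof.
move=> IJ.
have eqF F : min_graded_free_resolution F I <-> min_graded_free_resolution F J.
  by split=> -[? ? im ? ? ?]; split=> // p; rewrite -im; [rewrite -IJ | rewrite IJ].
have eqB i j b : graded_betti I i j b <-> graded_betti J i j b.
  by split=> -[F [resF ->]]; exists F; split=> //; apply/eqF.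
move=> [[i [j [b [B nz rE]]]] ub]; split; first by exists i, j, b; split=> //; apply/eqB.
by move=> t [i' [j' [b' [/eqB B' nz' tE]]]]; apply: ub; exists i', j', b'.
Qed.

(** A monomial that is minimal in [M] can only be written with a generator that
    contains it with a constant coefficient, so its degree is a shift of the
    first module. *)
Lemma min_generator_shift M F m : min_graded_free_resolution F (@monomials_in M) ->
  minimal_in M m -> exists a : 'I_(rk F 0), shift a = (mdeg m)%:Z.
Proof.
move=> /min_resolution_graded resF [Mm mmin].
have [v vE] := (res_image resF _).1 ((monomials_inX M m).2 Mm).
apply: NNPP => none.
have /(congr1 (mcoeff m)) : (v *m aug F) 0 0 = 'X_[m] by rewrite vE mxE eqxx.
rewrite mxE (raddf_sum (mcoeff m)) mcoeffX eqxx big1 => [/esym/eqP|a _ /=]; first by rewrite oner_eq0.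
rewrite mcoeffM big1 // => -[k1 k2] /= /eqP mE.
have [k2a|/memN_msupp_eq0 ->] := boolP (bmnm k2 \in msupp (aug F a 0)); last by rewrite mulr0.
case: none; exists a.
have k2m : bmnm k2 = m.
  by apply: mmin; [apply: (aug_in a resF) | rewrite [X in (_ <= X)%MM]mE lem_addl].
have /homog_degP/(_ _ k2a) := res_graded resF (i := 0%N) a 0.
by rewrite k2m /= subr0.
Qed.

(** An upper bound by one resolution together with a minimal generator that
    attains it determine the regularity. *)
Lemma regularity_monomials M m : upset M ->
  reg_le (@monomials_in M) (mdeg m)%:Z -> minimal_in M m ->
  regularity (@monomials_in M) (mdeg m)%:Z.
Proof.
move=> uM [P resP leP] mmin.
have [F minF] : exists F, min_graded_free_resolution F (@monomials_in M).
  apply: min_resolution_exists => [|p q|p q|z p].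
  - exact: monomials_in0.
  - exact: monomials_inD.
  - exact: monomials_inM.
  - exact: monomials_in_hcomp.
split=> [|t [i [j [b [[G [minG ->]]]]]]].
  have [a aE] := min_generator_shift minF mmin.
  exists 0%N, (mdeg m)%:Z, #|[set a : 'I_(rk F 0) | shift a == (mdeg m)%:Z]|.
  split; last by rewrite subr0.
    by exists F.
  by rewrite -lt0n; apply/card_gt0P; exists a; rewrite inE aE.
rewrite -lt0n => /card_gt0P[a]; rewrite inE => /eqP <- ->.
by rewrite lerBlDr; exact: min_shift_le minG resP leP i a.
Qed.

Lemma reg_le_principal l (r : int) : (mdeg l)%:Z <= r ->
  reg_le (@monomials_in (fun a => (l <= a)%MM)) r.
Proof.
move=> lr; pose F : free_sequence K n := {|
  rk := fun i => if i is _.+1 then 0%N else 1%N;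
  shift := fun i _ => (mdeg l)%:Z; diff := fun i => 0; aug := const_mx 'X_[l] |}.
exists F; last by case=> [|i] a; [rewrite addr0 | case: a].
split.
- case=> [|i] a b; last by case: a.
  by rewrite mxE subr0 /= dhomogX.
- move=> p; split=> [lp|[v vE]].
    exists (\sum_(m <- msupp p) p@_m *: 'X_[m - l])%:M.
    apply/matrixP => i j; rewrite !ord1 mxE big_ord1 !mxE eqxx mulr1n mulr_suml.
    rewrite [RHS]mpolyE big_seq [RHS]big_seq; apply: eq_bigr => m /lp lm.
    by rewrite -scalerAl -mpolyXD submK.
  have -> : p = v 0 0 * 'X_[l].
    by move/matrixP/(_ 0 0): vE; rewrite !mxE big_ord1 mxE eqxx mulr1n => <-.
  move=> m; rewrite (perm_mem (msuppMX _ _)) => /mapP[m' _ ->]; exact: lem_addr.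
case=> [|i] v /=; last first.
  by split=> _; [exists 0; rewrite [v]thinmx0 [RHS]thinmx0 | rewrite [v]thinmx0 mul0mx].
split=> [v0|[w ->]]; last by rewrite mulmx0 mul0mx.
exists 0; rewrite mulmx0; apply/matrixP => i j; rewrite !ord1 mxE.
move/matrixP/(_ 0 0): v0; rewrite !mxE big_ord1 mxE => /eqP.
by rewrite mulf_eq0 -[_ == 0 :> S]msupp_eq0 -[X in _ || X]msupp_eq0 msuppX orbF msupp_eq0 => /eqP.
Qed.

(** For monomial ideals, sums and intersections of ideals are unions and
    intersections of sets of monomials. *)
Lemma reg_le_union M MA MB (r : int) : (forall a, M a <-> MA a \/ MB a) ->
    reg_le (@monomials_in MA) r -> reg_le (@monomials_in MB) r ->
    reg_le (@monomials_in (fun a => MA a /\ MB a)) (r + 1) ->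
  reg_le (@monomials_in M) r.
Proof.
move=> ME rA rB [P resP leP]; apply: (reg_le_sum rA rB).
  exists P => //; apply: eq_graded_resolution resP => p; split=> [h|[hA hB] m mp].
    by split=> m /h[].
  by split; [exact: hA | exact: hB].
move=> p; split=> [[a [b [hA hB ->]]]|h].
  by apply: monomials_inD => m => [/hA|/hB] ?; apply/ME; [left | right].
have inD P1 (s : seq 'X_{1..n}) (c : S) :
    (forall m, m \in s -> P1 m) -> monomials_in P1 (\sum_(m <- s) c@_m *: 'X_[m]).
  move=> sP; rewrite big_seq; elim/big_ind: _ => [|x y|m /sP Pm m'].
  - exact: monomials_in0.
  - exact: monomials_inD.
  - by move=> /msuppZ_le; rewrite msuppX inE => /eqP ->.
pose dA m : bool := if excluded_middle_informative (MA m) then true else false.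
exists (\sum_(m <- [seq m <- msupp p | dA m]) p@_m *: 'X_[m]).
exists (\sum_(m <- [seq m <- msupp p | ~~ dA m]) p@_m *: 'X_[m]).
split.
- apply: inD => m; rewrite mem_filter /dA.
  by case: excluded_middle_informative.
- apply: inD => m; rewrite mem_filter /dA => /andP[nA /h/ME[] //].
  by case: excluded_middle_informative nA.
by rewrite !big_filter {1}[p]mpolyE (bigID dA).
Qed.

End MonomialIdeals.

(** * Claws and short cycles *)

Section Covers.
Variables (n : nat) (e : rel 'I_n).
Hypotheses (e_sym : ssrbool.symmetric e) (e_irr : irreflexive e).
Hypotheses (e_claw : claw_free e) (e_cyc : only_C3_C5 e).
Implicit Types (l m : 'X_{1..n}) (a b c d f u v w x y z : 'I_n).

Lemma no_claw x u v w : e x u -> e x v -> e x w -> u != v -> u != w -> v != w ->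
  e u v || e u w || e v w.
Proof.
move=> xu xv xw uv uw vw; apply/negPn/negP => /norP[/norP[/negPf nuv /negPf nuw] /negPf nvw].
apply: e_claw; exists (fun i : 'I_4 => nth x [:: x; u; v; w] i).
have nx z : e x z -> x == z = false by move=> xz; apply: contraTF xz => /eqP ->; rewrite e_irr.
have uq : uniq [:: x; u; v; w].
  by rewrite /= !inE (nx _ xu) (nx _ xv) (nx _ xw) (negPf uv) (negPf uw) (negPf vw).
split=> [i j /eqP|]; first by rewrite nth_uniq // => /eqP/val_inj.
by case=> [[|[|[|[|//]]]] ?]; case=> [[|[|[|[|//]]]] ?] /=;
  rewrite /K13 -?val_eqE /= ?e_irr ?xu ?xv ?xw ?nuv ?nuw ?nvw //;
  rewrite e_sym ?xu ?xv ?xw ?nuv ?nuw ?nvw.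
Qed.

(** A five-cycle is a connected component: a chord would create a four-cycle, and
    a further neighbour [z] of [a] is, by claw-freeness, adjacent to one of the
    cycle neighbours of [a], which creates a cycle of length six. *)
Lemma five_cycle_neighbors a b c d f z :
  ucycle e [:: a; b; c; d; f] -> e a z -> z = b \/ z = f.
Proof.
rewrite /ucycle /= !inE !negb_or !andbT.
case/andP=> [/and5P[ab bc cd df fa]].
case/and4P=> [/and4P[nab nac nad naf] /and3P[nbc nbd nbf] /andP[ncd ncf] ndf] az.
have cyc s : (2 < size s)%N -> size s != 3%N -> size s != 5%N -> ucycle e s -> False.
  by move=> s2 s3 s5 /(e_cyc s2)[] /eqP; [apply/negP | apply/negP].
have [->|nzb] := eqVneq z b; first by left.
have [->|nzf] := eqVneq z f; first by right.
have naz : a != z by apply: contraTneq az => ->; rewrite e_irr.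
have [ezc|nzc] := eqVneq z c.
  exfalso; apply: (@cyc [:: a; c; d; f]) => //; rewrite /ucycle /= !inE !negb_or.
  by rewrite -ezc az ezc cd df fa nac nad naf ncd ncf ndf.
have [ezd|nzd] := eqVneq z d.
  exfalso; apply: (@cyc [:: a; b; c; d]) => //; rewrite /ucycle /= !inE !negb_or.
  by rewrite -ezd (e_sym z) az ezd ab bc cd nac nad nab nbc nbd ncd.
exfalso; have /orP[/orP[bf|bz]|fz] : e b f || e b z || e f z.
  by apply: (@no_claw a); rewrite // 1?(e_sym a f) // eq_sym.
- apply: (@cyc [:: b; c; d; f]) => //; rewrite /ucycle /= !inE !negb_or.
  by rewrite (e_sym f) bf bc cd df nbc nbd nbf ncd ncf ndf.
- apply: (@cyc [:: a; z; b; c; d; f]) => //; rewrite /ucycle /= !inE !negb_or.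
  by rewrite (e_sym z) bz az bc cd df fa naz nab nac nad naf nzb nzc nzd nzf nbc nbd nbf ncd ncf ndf.
- apply: (@cyc [:: a; b; c; d; f; z]) => //; rewrite /ucycle /= !inE !negb_or.
  rewrite fz (e_sym z) az ab bc cd df naz nab nac nad naf !(eq_sym _ z).
  by rewrite nzb nzc nzd nzf nbc nbd nbf ncd ncf ndf.
Qed.

End Covers.

Section EndOfPath.
Variables (V : finType) (r : rel V).
Hypotheses (r_sym : ssrbool.symmetric r) (r_irr : irreflexive r).

Lemma unextendable_path x p : path r x p -> uniq (x :: p) -> exists y q,
  [/\ path r y q, uniq (y :: q), (size p <= size q)%N & forall z, r y z -> z \in q].
Proof.
have [d] := ubnP (#|V| - size p); elim: d x p => // d IH x p lt_d xp uq.
have [z /andP[xz nzp]|none] := pickP (fun z => r x z && (z \notin p)); last first.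
  exists x, p; split=> // z xz; have := none z; rewrite xz /=.
  by move/negbFE.
have uq' : uniq (z :: x :: p).
  rewrite /= inE negb_or nzp andbT; move: uq => /= ->; rewrite andbT.
  by apply: contraTneq xz => ->; rewrite r_irr.
have := max_card (mem (z :: x :: p)); rewrite (card_uniqP uq') /= => lt_p.
have [||y [q [yq uqq le_pq Nq]]] := IH z (x :: p) _ _ uq'.
- by move: lt_d lt_p => /=; set N := #|_|; lia.
- by rewrite /= r_sym xz.
by exists y, q; split=> //; apply: ltnW.
Qed.

Hypothesis r_cyc : only_C3_C5 r.

(** A neighbour of the first vertex on the path closes a cycle, whose length is 3
    or 5 unless the neighbour is the next vertex. *)
Lemma path_end_neighbor y q i : path r y q -> uniq (y :: q) -> (i < size q)%N ->
  r y (nth y q i) -> i \in [:: 0; 1; 3]%N.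
Proof.
move=> yq uq iq yi; have [->//|i0] := posnP i.
have szc : size (y :: take i.+1 q) = i.+2 by rewrite /= size_takel.
have : ucycle r (y :: take i.+1 q).
  rewrite /ucycle /= rcons_path take_path //= (last_nth y) size_takel // [nth _ _ _]/= nth_take //.
  rewrite r_sym yi /=; move: uq => /= /andP[yq' uq']; rewrite take_uniq // andbT.
  by apply: contra yq'; apply: mem_take.
move/r_cyc; rewrite szc !ltnS i0 => /(_ isT)[[->]|[->]] //.
Qed.

(** Take a path that cannot be extended at its first vertex [y], so that all
    neighbours of [y] lie on it, in position 0, 1 or 3. Position 3 closes a
    five-cycle; otherwise the neighbours, at most two, are consecutive on the path
    and hence adjacent, so that [y] is simplicial. *)
Lemma end_of_path x0 x1 : r x0 x1 ->
  (exists x y, r y x /\ {in r y &, forall z z', z != z' -> r z z'}) \/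
  (exists a b c d f, ucycle r [:: a; b; c; d; f]).
Proof.
move=> x01; have [||y [q [yq uq szq Ny]]] := @unextendable_path x0 [:: x1].
- by rewrite /= x01.
- by rewrite /= inE andbT; apply: contraTneq x01 => ->; rewrite r_irr.
have {}Ny z : r y z -> exists2 i, i \in [:: 0; 1; 3]%N & z = nth y q i /\ (i < size q)%N.
  move=> yz; exists (index z q); last by rewrite nth_index ?index_mem ?Ny.
  by apply: (path_end_neighbor yq uq); rewrite ?index_mem ?nth_index ?Ny.
case: q yq uq szq Ny => [//|p0 q] yq uq _ Ny.
have yp0 : r y p0 by move: yq => /= /andP[].
have [yp3|yp3] := boolP ((3 < size (p0 :: q))%N && r y (nth y (p0 :: q) 3)).
  right; case: q yq uq yp3 {Ny} => [|p1 [|p2 [|p3 q]]] //= /and5P[_ p01 p12 p23 _] uq yp3.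
  exists y, p0, p1, p2, p3; rewrite /ucycle /= yp0 p01 p12 p23 r_sym yp3 /=.
  move: uq; rewrite !inE !negb_or.
  by case/and5P=> [/and5P[-> -> -> -> _] /and4P[-> -> -> _] /and3P[-> -> _] /andP[-> _] _].
left; exists p0, y; split=> //.
suff sub z : r y z -> z = p0 \/ (1 < size (p0 :: q))%N /\ z = nth y (p0 :: q) 1.
  have p01 : (1 < size (p0 :: q))%N -> r p0 (nth y (p0 :: q) 1).
    by case: q yq {uq Ny yp3 sub} => [|p1 q] //= /and3P[].
  by move=> z z' /sub[->|[h ->]] /sub[->|[h' ->]]; rewrite ?eqxx // => _; [|rewrite r_sym]; apply: p01.
move=> yz; have [i + [zE iq]] := Ny z yz; rewrite !inE => /or3P[] /eqP ei.
- by left; rewrite zE ei.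
- by right; rewrite -ei.
by case/negP: yp3; rewrite -ei iq -zE.
Qed.

End EndOfPath.

(** * Shedding vertices and regularity *)

Section Shedding.
Variables (n : nat) (e : rel 'I_n).
Hypotheses (e_sym : ssrbool.symmetric e) (e_irr : irreflexive e).
Hypotheses (e_claw : claw_free e) (e_cyc : only_C3_C5 e).
Variable k : nat.
Implicit Types (l m : 'X_{1..n}) (a b c d f u v w x y z : 'I_n).

(** The minimal elements of [kcover e k l]: no weight above its lower bound can be
    decreased, because it is tight along some edge. *)
Definition tight_cover l m := kcover e k l m /\
  forall v, (l v < m v)%N -> exists2 u, e v u & (m v + m u)%N = k.

(** The edges whose constraint is not already implied by the lower bounds. *)
Definition active l : rel 'I_n := fun x y => e x y && (l x + l y < k)%N.

(** Raising the bound at a shedding vertex creates no new minimal cover. This is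
    the analogue, for lower bounds, of the shedding vertices of a vertex
    decomposable complex. *)
Definition shedding l x := forall m, tight_cover (l + U_(x))%MM m -> tight_cover l m.

(** The only weight that can fail to be tight is the raised one, and only if it
    sits at its new bound. *)
Lemma sheddingP l x :
  (forall m, kcover e k (l + U_(x))%MM m -> m x = (l x).+1 ->
     (forall v, v != x -> (l v < m v)%N -> exists2 u, e v u & (m v + m u)%N = k) ->
     exists2 u, e x u & (m x + m u)%N = k) ->
  shedding l x.
Proof.
move=> h m [[lm km] tm]; have lm' := mnm_lepP lm.
have tm' v : v != x -> (l v < m v)%N -> exists2 u, e v u & (m v + m u)%N = k.
  by move=> vx lv; apply: tm; rewrite mnmDE mnm1E eq_sym (negPf vx) addn0.
split; first by split=> //; apply: lepm_trans lm; apply: lem_addr.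
move=> v lv; have [vx|] := eqVneq v x; last by move/tm'; apply.
rewrite {v}vx in lv *; have := lm' x; rewrite mnmDE mnm1E eqxx addn1 => lx.
have [mx|mx] := eqVneq (m x) (l x).+1; first exact: h.
by apply: tm; rewrite mnmDE mnm1E eqxx; lia.
Qed.

(** Let [y] be simplicial in the active graph and [x] a neighbour of [y] with the
    least bound. If the edge [x y] is not tight, the weight of [y] is above its
    bound, hence tight along another edge [y z], so the weight of [z] is at most
    [l x], and it is exactly [l x] by the choice of [x]. As [x z] is an active
    edge, [2 * l x < k], so the weights [l x + 1] and [l x] at its ends have sum at
    most [k]: this edge is tight. *)
Lemma simplicial_shedding l x y : active l y x ->
    {in active l y &, forall z z', z != z' -> active l z z'} ->
    (forall z, active l y z -> (l x <= l z)%N) ->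
  shedding l x.
Proof.
move=> /andP[yx lyx] simp minx; apply: sheddingP => m [lm km] mx tm.
have lm' v : (l v <= m v)%N by apply: leq_trans (mnm_lepP lm v); rewrite mnmDE leq_addr.
have [exy|ne] := eqVneq (m x + m y)%N k; first by exists y; rewrite // e_sym.
have kyx := km _ _ yx.
have yx_neq : y != x by apply: contraTneq yx => ->; rewrite e_irr.
have [|z yz tz] := tm y yx_neq; first lia.
have [zx|zx] := eqVneq z x; first by move: tz; rewrite zx; lia.
have ayz : active l y z by rewrite /active yz /=; have := lm' z; lia.
have axz : active l x z by apply: (simp x z) => //; [exact/andP | rewrite eq_sym].
case/andP: axz => xz lxz; exists z => //; have := km _ _ xz; have := minx z ayz; have := lm' z; lia.
Qed.

(** If neither edge at [a] is tight, the weights of [b] and [f] are above their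
    bounds and tight along [b c] and [f d]; then the weights of [c] and [d] are at
    most [l a], too small for the active edge [c d]. *)
Lemma five_cycle_shedding l a b c d f : ucycle (active l) [:: a; b; c; d; f] ->
  (l a <= l c)%N -> (l a <= l d)%N -> shedding l a.
Proof.
move=> cyc ac ad; have := cyc.
rewrite /ucycle /= !andbT => /andP[act uq].
case/and5P: act => [/andP[ab lab] /andP[bc _] /andP[cd lcd] /andP[df _] /andP[fa lfa]].
have ecyc : ucycle e [:: a; b; c; d; f].
  by rewrite /ucycle /= ab bc cd df fa /= !andbT; exact: uq.
have Nb z : e b z -> z = c \/ z = a.
  apply: (@five_cycle_neighbors _ e e_sym e_irr e_claw e_cyc b c d f a z).
  by rewrite -[[:: b; c; d; f; a]]/(rot 1 [:: a; b; c; d; f]) rot_ucycle.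
have Nf z : e f z -> z = a \/ z = d.
  apply: (@five_cycle_neighbors _ e e_sym e_irr e_claw e_cyc f a b c d z).
  by rewrite -[[:: f; a; b; c; d]]/(rot 4 [:: a; b; c; d; f]) rot_ucycle.
apply: sheddingP => m [lm km] mx tm.
have [eab|neab] := eqVneq (m a + m b)%N k; first by exists b.
have [eaf|neaf] := eqVneq (m a + m f)%N k; first by exists f; rewrite // e_sym.
have af : e a f by rewrite e_sym.
have slack v : e a v -> (m a + m v)%N != k -> (k <= l a + m v)%N.
  by move=> av nk; rewrite -ltnS -addSn -mx ltn_neqAle eq_sym nk km.
have above v : (l a + l v < k)%N -> (k <= l a + m v)%N -> (l v < m v)%N.
  by move=> lt le; rewrite -(ltn_add2l (l a)) (leq_trans lt).
have low v w : (k <= l a + m v)%N -> (m v + m w)%N = k -> (m w <= l a)%N.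
  by move=> le tvw; rewrite -(leq_add2l (m v)) tvw addnC.
have sb := slack b ab neab; have sf := slack f af neaf.
have nba : b != a by apply: contraTneq ab => ->; rewrite e_irr.
have nfa : f != a by apply: contraTneq af => ->; rewrite e_irr.
rewrite addnC in lfa.
have [u /Nb bu tu] := tm b nba (above b lab sb).
have [w /Nf fw tw] := tm f nfa (above f lfa sf).
have uc : u = c by case: bu => // ua; case/eqP: neab; rewrite addnC -ua.
have wd : w = d by case: fw => // wa; case/eqP: neaf; rewrite addnC -wa.
rewrite uc in tu; rewrite wd in tw.
have := leq_add (low b c sb tu) (low f d sf tw); have := leq_add ac ad.
by move=> h1 h2; have := leq_ltn_trans (leq_trans (km _ _ cd) (leq_trans h2 h1)) lcd; rewrite ltnn.
Qed.

Lemma active_sym l : ssrbool.symmetric (active l).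
Proof. by move=> x y; rewrite /active e_sym addnC. Qed.

Lemma active_irr l : irreflexive (active l).
Proof. by move=> x; rewrite /active e_irr. Qed.

Lemma active_C3_C5 l : only_C3_C5 (active l).
Proof.
move=> s s2 /andP[cyc uq]; apply: e_cyc => //; rewrite /ucycle uq andbT.
by apply: sub_cycle cyc => x y /andP[].
Qed.

Lemma shedding_exists l x0 y0 : active l x0 y0 -> exists x y, active l x y /\ shedding l x.
Proof.
case/(end_of_path (@active_sym l) (@active_irr l) (@active_C3_C5 l)) => [[x1 [y [yx1 simp]]]|].
  case: (arg_minnP (P := active l y) (fun x => l x) yx1) => x yx xmin.
  exists x, y; split; first by rewrite active_sym.
  exact: simplicial_shedding yx simp xmin.
move=> [a [b [c [d [f cyc]]]]].
have [x xs xmin] := arg_minnP (P := mem [:: a; b; c; d; f]) (fun x => l x) (mem_head a _).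
have [i s rotE] := rot_to xs.
have : size (rot i [:: a; b; c; d; f]) = 5%N by rewrite size_rot.
rewrite rotE; case: s rotE => [|b' [|c' [|d' [|f' [|]]]]] //= rotE _.
have cyc' : ucycle (active l) [:: x; b'; c'; d'; f'] by rewrite -rotE rot_ucycle.
have minE z : z \in [:: x; b'; c'; d'; f'] -> (l x <= l z)%N by rewrite -rotE mem_rot => /xmin.
exists x, b'; split; first by case/andP: cyc' => /= /andP[].
by apply: five_cycle_shedding cyc' _ _; apply: minE; rewrite !inE eqxx ?orbT.
Qed.

Lemma deficit_lt l m v : (l <= m)%MM -> (l v < m v)%N -> (l v < k)%N ->
  (\sum_v (k - m v) < \sum_v (k - l v))%N.
Proof.
move=> /mnm_lepP lm lmv lvk; rewrite [X in (X < _)%N](bigD1 v) // [X in (_ < X)%N](bigD1 v) //=.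
rewrite -addSn leq_add //; first lia.
by apply: leq_sum => u _; rewrite leq_sub2l.
Qed.

(** The bounds describing the covers with weight exactly [l x] at [x]: the
    neighbours of [x] are raised until all edges at [x] are satisfied. *)
Definition freeze l x := [multinom if e x v then maxn (l v) (k - l x) else l v | v < n].

Lemma freezeE l x v : freeze l x v = if e x v then maxn (l v) (k - l x) else l v.
Proof. exact: mnmE. Qed.

Lemma le_freeze l x : (l <= freeze l x)%MM.
Proof. by apply/mnm_lepP => v; rewrite freezeE; case: ifP => // _; exact: leq_maxl. Qed.

Lemma freeze_self l x : freeze l x x = l x.
Proof. by rewrite freezeE e_irr. Qed.

Lemma freeze_value l x m : (l x <= k)%N -> tight_cover (freeze l x) m -> m x = l x.
Proof.
move=> lxk [[/mnm_lepP lm km] tm]; have := lm x; rewrite freeze_self => lx.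
apply/eqP; rewrite eqn_leq lx andbT leqNgt; apply/negP => lt.
have [|u xu tu] := tm x; first by rewrite freeze_self.
have := lm u; rewrite freezeE xu; lia.
Qed.

Lemma tight_cover_freeze l x m : (l x <= k)%N ->
  tight_cover (freeze l x) m -> tight_cover l m.
Proof.
move=> lxk tc; have mx := freeze_value lxk tc; case: tc => [[lm km] tm].
split; first by split=> //; apply: lepm_trans lm; apply: le_freeze.
move=> v lv; have [ltv|lev] := ltnP (freeze l x v) (m v); first exact: tm.
have := mnm_lepP lm v; move: lev; rewrite freezeE; case: ifP => [xv|_]; last lia.
by move=> h1 h2; exists x; [rewrite e_sym | lia].
Qed.

(** No constraint at [x] is left in [freeze l x], so raising its bound at [x] by
    one multiplies all generators by the variable of [x]. *)
Lemma tight_cover_freezeD l x m : (l x < k)%N ->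
    tight_cover (freeze l x + U_(x))%MM m ->
  (U_(x) <= m)%MM /\ tight_cover (freeze l x) (m - U_(x))%MM.
Proof.
move=> lxk [[lm km] tm]; have lm' := mnm_lepP lm.
have mx : m x = (l x).+1.
  have := lm' x; rewrite mnmDE mnm1E eqxx freeze_self addn1 => lx.
  apply/eqP; rewrite eqn_leq lx andbT leqNgt; apply/negP => lt.
  have [|u xu tu] := tm x; first by rewrite mnmDE mnm1E eqxx freeze_self addn1.
  have ux : x == u = false by apply: contraTF xu => /eqP ->; rewrite e_irr.
  by have := lm' u; rewrite mnmDE mnm1E freezeE xu ux; lia.
have m'E v : (m - U_(x))%MM v = if v == x then l x else m v.
  rewrite mnmBE mnm1E eq_sym; case: eqP => [->|_]; [rewrite mx; lia | exact: subn0].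
have fE v : v != x -> (freeze l x v <= m v)%N.
  by move=> vx; have := lm' v; rewrite mnmDE mnm1E eq_sym (negPf vx) addn0.
have nbr v : e x v -> (v != x) * (k - l x <= m v)%N.
  move=> xv; have vx : v != x by apply: contraTneq xv => ->; rewrite e_irr.
  by rewrite vx; split=> //; have := fE v vx; rewrite freezeE xv; lia.
split; first by rewrite lep1mP mx.
split; first split.
- apply/mnm_lepP => v; rewrite m'E; have [->|/fE//] := eqVneq v x.
  by rewrite freeze_self.
- move=> i j ij; rewrite !m'E; have [ix|ix] := eqVneq i x.
    have [jx hj] : (j != x) * (k - l x <= m j)%N by apply: nbr; rewrite -ix.
    by rewrite (negPf jx); lia.
  have [jx|jx] := eqVneq j x; last exact: km.
  have [_ hi] : (i != x) * (k - l x <= m i)%N by apply: nbr; rewrite e_sym -jx.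
  lia.
move=> v; rewrite m'E; have [->|vx] := eqVneq v x; first by rewrite freeze_self ltnn.
move=> lv; have [|u vu tu] := tm v; first by rewrite mnmDE mnm1E eq_sym (negPf vx) addn0.
exists u => //; rewrite m'E; have [ux|//] := eqVneq u x.
have xv : e x v by rewrite e_sym -ux.
by move: lv; rewrite freezeE xv -tu ux mx; lia.
Qed.

(** A cover has weight exactly [l x] at [x], or more. *)
Lemma kcover_split l x m : (l x <= k)%N ->
  kcover e k l m <-> kcover e k (freeze l x) m \/ kcover e k (l + U_(x))%MM m.
Proof.
move=> lxk; split=> [[lm km]|[[lm km]|[lm km]]]; last 2 first.
- by split=> //; apply: lepm_trans lm; apply: le_freeze.
- by split=> //; apply: lepm_trans lm; apply: lem_addr.
have lm' := mnm_lepP lm; have [mx|mx] := eqVneq (m x) (l x); [left | right]; split=> //.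
  apply/mnm_lepP => v; rewrite freezeE; case: ifP => // xv.
  by have := km _ _ xv; have := lm' v; lia.
apply/mnm_lepP => v; rewrite mnmDE mnm1E; case: eqP => [<-|_]; last by rewrite addn0.
by have := lm' x; lia.
Qed.

Lemma kcover_and l x m : 
  kcover e k (freeze l x + U_(x))%MM m <->
  kcover e k (freeze l x) m /\ kcover e k (l + U_(x))%MM m.
Proof.
split=> [[lm km]|[[lm km] [lm' _]]].
  split; split=> //; apply: lepm_trans lm; first exact: lem_addr.
  by apply/mnm_lepP => v; rewrite !mnmDE leq_add2r (mnm_lepP (le_freeze l x)).
split=> //; apply/mnm_lepP => v; rewrite mnmDE mnm1E; have [<-|_] := eqVneq x v.
  by have := mnm_lepP lm' x; rewrite mnmDE mnm1E eqxx freeze_self.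
by rewrite addn0; exact: (mnm_lepP lm).
Qed.

(** The regularity is bounded by the largest degree of a minimal generator. If no
    edge is active the ideal is principal. Otherwise it is the sum of the ideals
    of [freeze l x] and [l + U_(x)] for a shedding vertex [x], which have no new
    minimal generators, and their intersection has generators of degree at most
    [D + 1]; all three have larger bounds. *)
Lemma reg_le_kcover (K : fieldType) l (D : nat) : (forall v, (l v <= k)%N) ->
    (forall m, tight_cover l m -> (mdeg m <= D)%N) ->
  reg_le (@monomials_in K n (kcover e k l)) D%:Z.
Proof.
have [d] := ubnP (\sum_v (k - l v)); elim: d l D => // d IH l D ld lk degD.
have [[x0 [y0 a0]]|none] := classic (exists x y, active l x y); last first.
  have km m : (l <= m)%MM -> forall i j, e i j -> (k <= m i + m j)%N.
    move=> lm i j ij; rewrite leqNgt; apply/negP => lt; apply: none; exists i, j.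
    by rewrite /active ij (leq_ltn_trans _ lt) // leq_add // (mnm_lepP lm).
  have lD : (mdeg l)%:Z <= D%:Z.
    apply: degD; split.
      by split=> [|i j ij]; [exact: lepm_refl | exact: km (lepm_refl _) _ _ ij].
    by move=> v; rewrite ltnn.
  have [P resP leP] := reg_le_principal K lD; exists P => //.
  apply: eq_graded_resolution resP => p; split=> h m /h; last by case.
  by move=> lm; split=> // i j; apply: km.
have [x [y [axy shx]]] := shedding_exists a0.
have /andP[exy lxy] := axy; have lxk : (l x < k)%N by lia.
have xy : x == y = false by apply: contraTF exy => /eqP ->; rewrite e_irr.
have fk v : (freeze l x v <= k)%N by rewrite freezeE; have := lk v; case: ifP => _; lia.
have lUk v : ((l + U_(x))%MM v <= k)%N.
  by rewrite mnmDE mnm1E; have := lk v; case: eqP => [<-|_]; lia.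
have lf := le_freeze l x; have lU : (l <= l + U_(x))%MM by apply: lem_addr.
apply: (@reg_le_union _ _ _ (kcover e k (freeze l x)) (kcover e k (l + U_(x))%MM)).
- by move=> m; apply: kcover_split; apply: ltnW.
- apply: IH => // [|m tm]; last by apply: degD; apply: tight_cover_freeze tm; apply: ltnW.
  rewrite -ltnS (leq_trans _ ld) // ltnS (@deficit_lt _ _ y) //; last lia.
  by rewrite freezeE exy; lia.
- apply: IH => // [|m tm]; last by apply: degD; apply: shx.
  rewrite -ltnS (leq_trans _ ld) // ltnS (@deficit_lt _ _ x) //.
  by rewrite mnmDE mnm1E eqxx addn1.
have [|v|m /(tight_cover_freezeD lxk)[Um tm]|P resP leP] := IH (freeze l x + U_(x))%MM D.+1.
- rewrite -ltnS (leq_trans _ ld) // ltnS (@deficit_lt _ _ x) //.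
    exact: lepm_trans lf (lem_addr _ _).
  by rewrite mnmDE mnm1E eqxx freeze_self addn1.
- rewrite mnmDE mnm1E; have := fk v; have [<-|_] := eqVneq x v; last by rewrite addn0.
  by rewrite freeze_self; lia.
- rewrite -(submK Um) mdegD mdeg1 addn1 ltnS; apply: degD.
  by apply: tight_cover_freeze tm; apply: ltnW.
exists P; last by move=> i a; rewrite (le_trans (leP i a)) // -addn1 PoszD.
by apply: eq_graded_resolution resP => p; split=> h m /h/kcover_and.
Qed.

End Shedding.

(** * Independent domination in claw-free graphs *)

Section Domination.
Variables (n : nat) (e : rel 'I_n).
Hypotheses (e_sym : ssrbool.symmetric e) (e_irr : irreflexive e) (e_claw : claw_free e).
Implicit Types (U D : {set 'I_n}) (u v w x : 'I_n).

Definition nbhd U x := [set u in U | e x u].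
Definition isolated U := [set v in U | nbhd U v == set0].

Lemma isolatedP U v : reflect (v \in U /\ forall u, u \in U -> ~~ e v u) (v \in isolated U).
Proof.
rewrite inE; apply: (iffP andP) => -[vU h]; split=> //.
  by move=> u uU; apply/negP => vu; move/eqP/setP/(_ u): h; rewrite !inE uU vu.
by apply/eqP/setP => u; rewrite !inE; have [/h/negPf|] := boolP (u \in U).
Qed.

Definition independent D := forall u v, u \in D -> v \in D -> ~~ e u v.

Definition dominates D U := forall v, v \in U -> v \in D \/ exists2 u, u \in D & e v u.

Definition cheap_domination U := exists D,
  [/\ D \subset U, independent D, dominates D U & (2 * #|D| <= #|U| + #|isolated U|)%N].

(** Put [x] in the dominating set and delete its closed neighbourhood; the deleted
    vertices pay for [x] and for the vertices that become isolated. *)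
Lemma cheap_domination_step U x : x \in U -> let U' := U :\: (x |: nbhd U x) in
  (#|isolated U'| < #|isolated U| + #|nbhd U x|)%N -> cheap_domination U' -> cheap_domination U.
Proof.
move=> xU U' le_iso [D [DU indD domD le_D]]; exists (x |: D).
have DU' u : u \in D -> [&& u != x, u \in U & ~~ e x u].
  by move/(subsetP DU); rewrite !inE negb_or => /andP[/andP[-> h] uU]; rewrite uU in h *.
split.
- by apply/subsetP => u; rewrite !inE => /predU1P[->//|/DU'/and3P[]].
- move=> u v; rewrite !inE => /predU1P[->|uD] /predU1P[->|vD].
  + by rewrite e_irr.
  + by case/and3P: (DU' v vD).
  + by rewrite e_sym; case/and3P: (DU' u uD).
  + exact: indD.
- move=> v vU; have [vx|vx] := eqVneq v x; first by left; rewrite vx setU11.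
  have [xv|xv] := boolP (e x v); first by right; exists x; rewrite ?setU11 // e_sym.
  have [|vD|[u uD vu]] := domD v; first by rewrite !inE vU negb_or vx xv.
    by left; rewrite setU1r.
  by right; exists u; rewrite ?setU1r.
have xN : x \notin nbhd U x by rewrite inE e_irr andbF.
have xD : x \notin D by apply/negP => /DU'; rewrite eqxx.
have := cardsD U (x |: nbhd U x); rewrite -/U' (setIidPr _); last first.
  by apply/subsetP => u; rewrite !inE => /predU1P[->//|/andP[]].
have le_U : (#|x |: nbhd U x| <= #|U|)%N.
  by apply/subset_leq_card/subsetP => u; rewrite !inE => /predU1P[->//|/andP[]].
move: le_U le_D le_iso; rewrite !cardsU1 xN xD !add1n.
move: #|U'| #|isolated U'| #|D| #|isolated U| #|nbhd U x| #|U| => *; lia.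
Qed.

(** Choose a non-isolated [x] of least degree. A vertex [w] that becomes isolated
    has its neighbours among those of [x], hence the same neighbours, by
    minimality; two such vertices and [x] would form a claw at a common neighbour.
    So at most one vertex becomes isolated, and the step is affordable unless [x]
    and [w] are the two ends of a path with middle [u], which is then a component:
    [u] dominates it alone. *)
Lemma claw_free_domination U : cheap_domination U.
Proof.
have [d] := ubnP #|U|; elim: d U => // d IH U ltUd.
have [|[x0 x0P]] := set_0Vmem [set x in U | nbhd U x != set0].
  move=> /setP noN; have allI v : v \in U -> v \in isolated U.
    by move=> vU; rewrite inE vU; have := noN v; rewrite !inE vU /= => /negbFE.
  exists U; split=> // [u v uU vU|v vU|].
  - by have /isolatedP[_] := allI u uU; apply.
  - by left.
  - by rewrite mul2n -addnn leq_add2l; apply/subset_leq_card/subsetP.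
have [x] := arg_minnP (P := mem [set x in U | nbhd U x != set0]) (fun x => #|nbhd U x|) x0P.
rewrite !inE => /andP[xU Nx] xmin.
have smaller y : y \in U -> cheap_domination (U :\: (y |: nbhd U y)).
  move=> yU; apply: IH; rewrite -ltnS (leq_trans _ ltUd) // ltnS; apply: proper_card.
  apply/properP; split; first exact: subsetDl.
  by exists y; rewrite // !inE eqxx.
pose U' := U :\: (x |: nbhd U x).
have newP w : w \in isolated U' :\: isolated U ->
    [/\ w \in U, w != x, ~~ e x w & nbhd U w = nbhd U x].
  rewrite in_setD => /andP[wiso /isolatedP[]].
  rewrite !inE negb_or => /andP[/andP[wx xw] wU] wU'; rewrite wU /= in xw; split=> //.
  have wNx : nbhd U w \subset nbhd U x.
    apply/subsetP => u; rewrite !inE => /andP[uU wu]; rewrite uU; apply/negPn/negP => xu.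
    have ux : u != x by apply: contraNneq xw => <-; rewrite e_sym.
    by have := wU' u; rewrite !inE uU negb_or ux xu wu => /(_ isT).
  apply/eqP; rewrite eqEcard wNx; apply: xmin; rewrite !inE wU /=.
  by apply: contra wiso => wN; rewrite inE wU.
have le_new : (#|isolated U' :\: isolated U| <= 1)%N.
  apply/card_le1P => w wnew w'; apply/idP/idP => [w'new|/eqP-> //].
  rewrite inE; apply/negPn/negP => ww'.
  have [wU wx xw NwE] := newP w wnew; have [w'U w'x xw' Nw'E] := newP w' w'new.
  have [u uN] := set0Pn _ Nx; have := uN; rewrite inE => /andP[uU xu].
  have := uN; rewrite -NwE inE => /andP[_ wu]; have := uN; rewrite -Nw'E inE => /andP[_ w'u].
  have /orP[/orP[h|h]|h] : e x w || e x w' || e w w'.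
    by apply: (no_claw e_sym e_irr e_claw (x := u)); rewrite 1?e_sym // eq_sym.
  - by rewrite h in xw.
  - by rewrite h in xw'.
  by move: w'new; rewrite in_setD => /andP[_ /isolatedP[w'U' _]]; move: wnew;
    rewrite in_setD => /andP[_ /isolatedP[_ /(_ w' w'U')]]; rewrite h.
have le_iso : (#|isolated U'| <= #|isolated U| + #|isolated U' :\: isolated U|)%N.
  by rewrite -(cardsID (isolated U)) leq_add2r subset_leq_card // subsetIr.
have [lt_iso|] := ltnP #|isolated U'| (#|isolated U| + #|nbhd U x|)%N.
  exact: cheap_domination_step xU lt_iso (smaller x xU).
have Nx_pos : (0 < #|nbhd U x|)%N by rewrite card_gt0.
move=> ge_iso.
have le_Nx : (#|nbhd U x| <= #|isolated U' :\: isolated U|)%N.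
  by rewrite -(leq_add2l #|isolated U|) (leq_trans ge_iso).
have [w wnew] : exists w, w \in isolated U' :\: isolated U.
  by apply/set0Pn; rewrite -card_gt0 (leq_trans Nx_pos).
have [wU wx xw NwE] := newP w wnew.
have /cards1P[u NxE] : #|nbhd U x| == 1%N by rewrite eqn_leq Nx_pos andbT (leq_trans le_Nx).
have uN : u \in nbhd U x by rewrite NxE set11.
have := uN; rewrite inE => /andP[uU xu].
have := uN; rewrite -NwE inE => /andP[_ wu].
have only_u v t : v \in [:: x; w] -> t \in U -> e v t -> t = u.
  move=> vxw tU vt; apply/set1P; rewrite -NxE.
  have -> : nbhd U x = nbhd U v.
    by move: vxw; rewrite in_cons mem_seq1 => /orP[]/eqP->.
  by rewrite inE tU.
have Nu : nbhd U u = [set x; w].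
  apply/setP => t; rewrite !inE; apply/idP/idP => [/andP[tU ut]|/orP[]/eqP->]; last 2 first.
  - by rewrite xU e_sym.
  - by rewrite wU e_sym.
  have [//|tx] := eqVneq t x; have [//|tw] := eqVneq t w.
  have tu : t != u by apply: contraTneq ut => ->; rewrite e_irr.
  have /orP[/orP[h|h]|h] : e x w || e x t || e w t.
    by apply: (no_claw e_sym e_irr e_claw (x := u)); rewrite // 1?e_sym // eq_sym.
  - by rewrite h in xw.
  - by move: tu; rewrite (only_u x t) ?mem_head ?eqxx.
  - by move: tu; rewrite (only_u w t) ?inE ?eqxx ?orbT.
have := smaller u uU; apply: (cheap_domination_step uU).
rewrite Nu cards2 eq_sym wx addn2 ltnS leqW // subset_leq_card //.
apply/subsetP => t /isolatedP[t_in tiso]; move: t_in.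
rewrite in_setD in_setU1 in_set2 !negb_or => /andP[/and3P[tu tx tw] tU].
apply/isolatedP; split=> // v vU; apply/negP => tv.
have [vE|vu] := eqVneq v u.
  have : t \in nbhd U u by rewrite inE tU e_sym -vE.
  by rewrite Nu !inE (negPf tx) (negPf tw).
have [vE|vx] := eqVneq v x; first by move: tu; rewrite (only_u x t) ?mem_head ?eqxx // -vE e_sym.
have [vE|vw] := eqVneq v w; first by move: tu; rewrite (only_u w t) ?inE ?eqxx ?orbT // -vE e_sym.
by have := tiso v; rewrite !inE !negb_or vu vx vw vU tv => /(_ isT).
Qed.

End Domination.

(** * Degrees of minimal covers *)

Section Degree.
Variables (n : nat) (e : rel 'I_n).
Hypotheses (e_sym : ssrbool.symmetric e) (e_irr : irreflexive e) (e_claw : claw_free e).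
Implicit Types (m : 'X_{1..n}) (u v w x : 'I_n).

Definition min_cover k m := tight_cover e k 0%MM m.

Lemma min_coverP k m : min_cover k m <-> minimal_in (kcover e k 0%MM) m.
Proof.
split=> [[cm tm]|[cm mmin]].
  split=> // a [_ ka] /mnm_lepP am; apply/mnmP => v; apply/eqP; rewrite eqn_leq am /= leqNgt.
  apply/negP => lt; have [|u vu tu] := tm v; first by rewrite mnm0E (leq_trans _ lt).
  by have := ka _ _ vu; have := am u; lia.
split=> // v; rewrite mnm0E => mv; apply: NNPP => none.
have Uv : (U_(v) <= m)%MM by rewrite lep1mP -lt0n.
suff /mmin/(_ (lem_subr _ _))/mnmP/(_ v) : kcover e k 0%MM (m - U_(v))%MM.
  by rewrite mnmBE mnm1E eqxx; lia.
split=> [|i j ij]; first exact: le0mnm.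
have km := cm.2 _ _ ij.
have nbr u : e v u -> (k < m v + m u)%N.
  move=> vu; rewrite ltn_neqAle (cm.2 _ _ vu) andbT; apply/eqP => kE.
  by apply: none; exists u.
have ne : i != j by apply: contraTneq ij => ->; rewrite e_irr.
rewrite !mnmBE !mnm1E; have [vi|vi] := eqVneq v i; have [vj|vj] := eqVneq v j.
- by move: ne; rewrite -vi -vj eqxx.
- by rewrite subn0 -vi; have := nbr j; rewrite vi => /(_ ij); rewrite -vi; lia.
- by rewrite subn0 -vj; have := nbr i; rewrite vj e_sym => /(_ ij); rewrite -vj; lia.
by rewrite !subn0.
Qed.

Lemma min_cover_le k m v : min_cover k m -> (m v <= k)%N.
Proof.
move=> [_ tm]; have [->//|mv] := posnP (m v).
by have [|u _ <-] := tm v; [rewrite mnm0E | apply: leq_addr].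
Qed.

Lemma min_cover_scale k m : min_cover 1 m -> min_cover k (m *+ k)%MM.
Proof.
move=> [[_ km] tm]; split=> [|v].
  split=> [|i j ij]; first exact: le0mnm.
  by rewrite !mulmnE -mulnDl -{1}[k]mul1n leq_mul2r km ?orbT.
rewrite mulmnE !mnm0E muln_gt0 => /andP[mv _].
have [|u vu tu] := tm v; first by rewrite mnm0E.
by exists u; rewrite // !mulmnE -mulnDl tu mul1n.
Qed.

Lemma complement_min_cover (D : {set 'I_n}) : independent e D -> dominates e D setT ->
  min_cover 1 [multinom (v \notin D : nat) | v < n].
Proof.
move=> indD domD; split.
  split=> [|i j ij]; first exact: le0mnm.
  rewrite !mnmE; have [iD|//] := boolP (i \in D); have [jD|//] := boolP (j \in D).
  by have := indD i j iD jD; rewrite ij.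
move=> v; rewrite mnmE mnm0E lt0b => vD.
have [vD'|[u uD vu]] := domD v (in_setT v); first by rewrite vD' in vD.
by exists u; rewrite // !mnmE vD uD.
Qed.

Lemma mdeg_complement (D : {set 'I_n}) :
  (mdeg [multinom (v \notin D : nat) | v < n] + #|D| = n)%N.
Proof.
rewrite mdegE; under eq_bigr => v _ do rewrite mnmE.
rewrite -big_mkcond /= sum1_card -[RHS]card_ord -(cardC (mem D)) addnC; congr (_ + _)%N.
Qed.

Lemma sum_ltn c k : (\sum_(i < k) (i < c) = minn c k)%N.
Proof.
elim: k => [|k IH]; first by rewrite big_ord0 minn0.
by rewrite big_ord_recr /= IH; lia.
Qed.

Section Levels.
Variables (k d : nat) (m : 'X_{1..n}).
Hypothesis m_min : min_cover k m.
Hypothesis d_max : forall m', min_cover 1 m' -> (mdeg m' <= d)%N.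

Definition level t := [set v | (t <= k - m v)%N].

(** The set [level t'] consists of the isolated vertices of [level t]: a vertex
    with [t <= k - m v < t'] has a tight edge inside [level t], and edges between
    the two sets violate the cover condition. So [level t] has an independent
    dominating set of size at most half of [#|level t| + #|level t'|]. It contains
    [level t'], hence dominates the vertices outside [level t], which are tight
    with a vertex of [level t']. Its complement is a minimal vertex cover, of size
    at most [d]. *)
Lemma level_domination t t' : (0 < t)%N -> (t <= t')%N -> (t + t' = k.+1)%N ->
  (2 * (n - d) <= #|level t| + #|level t'|)%N.
Proof.
move=> t0 tt' ttk; have mk v := min_cover_le v m_min; have [[_ km] tm] := m_min.
have tight v : (0 < m v)%N -> exists2 u, e v u & (m v + m u)%N = k.
  by move=> mv; apply: tm; rewrite mnm0E.
have [D [DA indD domD le_D]] := claw_free_domination e_sym e_irr e_claw (level t).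
have iso_sub : isolated e (level t) \subset level t'.
  apply/subsetP => v /isolatedP[]; rewrite !inE => tv viso; rewrite leqNgt; apply/negP => vt'.
  have mv : (0 < m v)%N by have := mk v; lia.
  have [u vu tu] := tight v mv; have /negP[//] : ~~ e v u.
  by apply: viso; rewrite inE; have := mk u; lia.
have domT : dominates e D setT.
  move=> v _; have [vA|vA] := boolP (v \in level t); first exact: domD.
  right; move: vA; rewrite inE -ltnNge => vt; have mv : (0 < m v)%N by have := mk v; lia.
  have [u vu tu] := tight v mv; exists u => //.
  have uA : u \in level t by rewrite inE; have := mk u; have := mk v; lia.
  have [//|[w wD uw]] := domD u uA.
  have := subsetP DA w wD; rewrite inE => wt.
  by have := km _ _ uw; have := mk w; have := mk u; have := mk v; lia.
have := d_max (complement_min_cover indD domT); have := mdeg_complement D.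
have := subset_leq_card iso_sub.
move: le_D; move: #|D| #|level t| #|level t'| #|isolated e (level t)| (mdeg _) => *; lia.
Qed.

(** Sum the previous bound over all thresholds [t], with [t' = k + 1 - t]. *)
Lemma min_cover_degree : (mdeg m <= k * d)%N.
Proof.
have mk v := min_cover_le v m_min.
have lev (i : 'I_k) : (2 * (n - d) <= #|level i.+1| + #|level (rev_ord i).+1|)%N.
  have sumE : (i.+1 + (rev_ord i).+1 = k.+1)%N by have := ltn_ord i; rewrite /=; lia.
  have [h|h] := leqP i (rev_ord i); first exact: level_domination sumE.
  by rewrite addnC; apply: level_domination; rewrite // ?ltnS ?(ltnW h) // addnC.
have sum_level : (\sum_(i < k) #|level i.+1| = \sum_v (k - m v))%N.
  have cardE t : #|level t| = (\sum_v (t <= k - m v))%N by rewrite -sum1dep_card big_mkcond.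
  rewrite (eq_bigr _ (fun (i : 'I_k) _ => cardE i.+1)) exchange_big; apply: eq_bigr => v _ /=.
  rewrite -[RHS](minn_idPl (leq_subr (m v) k)).
  exact: sum_ltn.
have sum_mdeg : (mdeg m + \sum_v (k - m v) = n * k)%N.
  rewrite mdegE -big_split /= -[n in RHS]card_ord -sum_nat_const.
  by apply: eq_bigr => v _; rewrite subnKC.
have sum_rev : (\sum_(i < k) #|level (rev_ord i).+1| = \sum_(i < k) #|level i.+1|)%N.
  by rewrite [RHS](reindex_inj rev_ord_inj).
have : (\sum_(i < k) 2 * (n - d) <=
        \sum_(i < k) #|level i.+1| + \sum_(i < k) #|level (rev_ord i).+1|)%N.
  by rewrite -big_split; apply: leq_sum => i _; exact: lev.
rewrite sum_rev sum_level.
rewrite sum_nat_const card_ord mulnA => le.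
have : (k * n <= k * (n - d) + k * d)%N by rewrite -mulnDr leq_mul2l; apply/orP; right; lia.
by move: sum_mdeg le; rewrite (mulnC n); set a := (\sum_v _)%N; lia.
Qed.

End Levels.
End Degree.

Lemma bounded_max (P : nat -> Prop) N m : P m -> (forall t, P t -> (t <= N)%N) ->
  exists2 d, P d & forall t, P t -> (t <= d)%N.
Proof.
move=> Pm leN; have [c] := ubnP (N - m); elim: c m Pm => // c IH m Pm lt_c.
have [[t [Pt mt]]|none] := classic (exists t, P t /\ (m < t)%N).
  by apply: (IH t Pt); have := leN t Pt; lia.
by exists m => // t Pt; rewrite leqNgt; apply/negP => mt; apply: none; exists t.
Qed.

Lemma largest_min_cover n (e : rel 'I_n) : ssrbool.symmetric e -> irreflexive e ->
  exists2 m, min_cover e 1 m & forall m', min_cover e 1 m' -> (mdeg m' <= mdeg m)%N.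
Proof.
move=> e_sym e_irr.
have [m0 m0_min _] : exists2 m, minimal_in (kcover e 1 0%MM) m & (m <= [multinom 1%N | i < n])%MM.
  apply: minimal_below; split=> [|i j ij]; first exact: le0mnm.
  by rewrite !mnmE.
pose P t := exists m, min_cover e 1 m /\ mdeg m = t.
have [|t [m [mm <-]]|d [m [mm mE]] dmax] := @bounded_max P n (mdeg m0).
- by exists m0; split=> //; apply/(min_coverP e_sym e_irr).
- rewrite mdegE -[X in (_ <= X)%N]card_ord -sum1_card; apply: leq_sum => v _.
  exact: min_cover_le mm.
by exists m => // m' mm'; rewrite mE; apply: dmax; exists m'.
Qed.

(** * The regularity of symbolic powers *)

Theorem theorem3p4 (K : fieldType) (n : nat) (e : rel 'I_n)
    (e_sym : ssrbool.symmetric e) (e_irr : irreflexive e)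
    (e_claw : claw_free e) (e_cyc : only_C3_C5 e) :
  exists d : nat, ideal_deg (@cover_ideal K n e) d /\
    forall k : nat, (1 <= k)%N ->
      regularity (@symbolic_power K n e k) (Posz (k * d)).
Proof.
have [m m_min m_max] := largest_min_cover e_sym e_irr; exists (mdeg m); split.
  have uc := @upset_kcover n e 1 0%MM.
  split=> [|t [A [a [genA Aa ->]]]].
    exists (minimal_in (kcover e 1 0%MM)), m; split=> //; last exact/(min_coverP e_sym e_irr).
    exact: eq_min_monomial_generators (same_set_sym (@cover_idealE K n e)) (minimal_generatorsP K uc).
  rewrite leEnat; apply: m_max; apply/(min_coverP e_sym e_irr).
  apply: minimal_generator_minimal Aa; exact: eq_min_monomial_generators (@cover_idealE K n e) genA.
move=> k _; have eqI := @symbolic_powerE K n e k e_irr.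
apply: (eq_regularity (same_set_sym eqI)).
have -> : (k * mdeg m)%N = mdeg (m *+ k)%MM by rewrite mdegMn mulnC.
apply: regularity_monomials.
- exact: upset_kcover.
- apply: reg_le_kcover => // [v|m' m'_min]; first by rewrite mnm0E.
  by rewrite mdegMn mulnC; apply: min_cover_degree e_sym e_irr e_claw _ _ _ m'_min m_max.
- by apply/(min_coverP e_sym e_irr)/min_cover_scale.
Qed.
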